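(* For the speed-scaling scheduling problems $P|size_j,pmtn*,r_j=r,d_j=d|E$ (preemption allowed, no migration) and $P|size_j,r_j=r,d_j=d|E$ (no preemption), in which all jobs share a common release time $r$ and a common deadline $d$, there is an algorithm running in $O(n^2)$ time that returns a feasible schedule whose total energy consumption is at most $\left(2-\frac{1}{m}\right)^{\alpha-1}$ times the minimum possible total energy consumption.
   Context: A system has $m$ identical parallel processors whose speeds can be changed dynamically over a continuous spectrum. A set $\mathcal{J}=\{1,\dots,n\}$ of rigid parallel jobs is given; job $j$ has a release time $r_j$, a deadline $d_j$, a processing volume (work) $W_j>0$ and a size $size_j\in\{1,\dots,m\}$, the number of processors it requires simultaneously. Any subset of $size_j$ processors may be used to execute job $j$, but migration is forbidden: job $j$ is executed throughout on one fixed set of $size_j$ processors. All processors executing the same job at the same time run at the same speed; the speed of a job is the rate at which its work is completed. Running a processor at speed $s$ consumes power $s^\alpha$, where $\alpha>1$ is a constant, and energy is power integrated over time (summed over all processors). A schedule is feasible if each processor executes at most one job at a time and each job $j$ has its whole work $W_j$ processed within $[r_j,d_j)$. The objective $E$ is to minimize the total energy consumption. In the notation, $pmtn*$ means preemption of jobs is allowed (but not migration), and its absence means jobs must be processed without interruption; $r_j=r$ and $d_j=d$ mean all jobs have the same release time $r$ and the same deadline $d$. *)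

(* Defs.v *)
From HB Require Import structures.
From mathcomp Require Import all_boot all_order all_algebra.
From mathcomp Require Import all_classical all_reals all_analysis.

Set Implicit Arguments.
Unset Strict Implicit.
Unset Printing Implicit Defensive.

Import Order.TTheory GRing.Theory Num.Theory.
Import numFieldNormedType.Exports.

Local Open Scope classical_set_scope.
Local Open Scope ring_scope.

(** * Speed-scaling scheduling of rigid parallel jobs *)

Record instance (R : realType) (n m : nat) := Instance {
  release : 'I_n -> R;
  deadline : 'I_n -> R;
  work : 'I_n -> R;
  jsize : 'I_n -> nat }.

Definition valid_instance (R : realType) (n m : nat) (I : instance R n m) :=
  forall j, 0 < work I j /\ (1 <= jsize I j <= m)%N.

(** [procs S j] is the fixed set of processors of job [j] (no migration), and
    [speed S j t] the common speed at time [t] of the processors in it; job [j]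
    is being executed at [t] exactly when this speed is positive. *)
Record schedule (R : realType) (n m : nat) := Schedule {
  procs : 'I_n -> {set 'I_m};
  speed : 'I_n -> R -> R }.

Definition executed (R : realType) (n m : nat) (S : schedule R n m)
  (j : 'I_n) : set R := [set t | 0 < speed S j t].

Variant problem := Preemptive | NonPreemptive.

Record feasible (R : realType) (n m : nat) (pb : problem)
    (I : instance R n m) (S : schedule R n m) : Prop := Feasible {
  feasible_size : forall j, #|procs S j| = jsize I j;
  feasible_measurable : forall j, measurable_fun setT (speed S j);
  feasible_ge0 : forall j t, 0 <= speed S j t;
  feasible_window : forall j,
    executed S j `<=` `[release I j, deadline I j[%classic;
  feasible_work : forall j,
    (\int[lebesgue_measure]_(t in `[release I j, deadline I j[%classic)
        (speed S j t)%:E = (work I j)%:E)%E;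
  feasible_disjoint : forall i j t, i != j ->
    executed S i t -> executed S j t -> [disjoint procs S i & procs S j]%B;
  feasible_interruption : pb = NonPreemptive ->
    forall j, is_interval (executed S j) }.

(** In a feasible schedule at most one term of the sum is nonzero. *)
Definition proc_speed (R : realType) (n m : nat) (S : schedule R n m)
  (p : 'I_m) (t : R) : R := \sum_(j < n | p \in procs S j) speed S j t.

Definition energy (R : realType) (n m : nat) (alpha : R)
    (S : schedule R n m) : \bar R :=
  (\sum_(p < m) \int[lebesgue_measure]_(t in setT)
      (proc_speed S p t `^ alpha)%:E)%E.

Definition min_energy (R : realType) (n m : nat) (alpha : R) (pb : problem)
    (I : instance R n m) : \bar R :=
  ereal_inf [set energy alpha S | S in [set S | feasible pb I S]].

(** * Unit-cost real RAM

    Structured programs over scalar variables and unbounded arrays, each of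
    two sorts: natural numbers and exact reals.  Variables and arrays are named
    by literals, so that a program uses finitely many of them.  Naturals have
    only [+] and truncated [-]; reals have the field operations (with
    [x / 0 = 0]), and there is no conversion from reals to naturals. *)

Inductive nexp :=
  | NConst of nat
  | NVar of nat
  | NGet of nat & nexp
  | NAdd of nexp & nexp
  | NSub of nexp & nexp.

Inductive rexp :=
  | ROfNat of nexp
  | RVar of nat
  | RGet of nat & nexp
  | RAdd of rexp & rexp
  | RSub of rexp & rexp
  | RMul of rexp & rexp
  | RDiv of rexp & rexp.

Inductive bexp :=
  | NEq of nexp & nexp
  | NLe of nexp & nexp
  | REq of rexp & rexp
  | RLe of rexp & rexp
  | BNot of bexp
  | BAnd of bexp & bexp.

Inductive com :=
  | Skip
  | NSet of nat & nexp           (* variable := value *)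
  | NPut of nat & nexp & nexp    (* array[index] := value *)
  | RSet of nat & rexp
  | RPut of nat & nexp & rexp
  | Seq of com & com
  | If of bexp & com & com
  | While of bexp & com.

Record state (R : Type) := State {
  nvar : nat -> nat;
  narr : nat -> nat -> nat;
  rvar : nat -> R;
  rarr : nat -> nat -> R }.

Definition upd (T : Type) (f : nat -> T) (x : nat) (v : T) : nat -> T :=
  fun y => if y == x then v else f y.

Section Semantics.
Variable R : realType.
Implicit Types (s : state R).

Fixpoint neval s (e : nexp) : nat :=
  match e with
  | NConst k => k
  | NVar x => nvar s x
  | NGet a i => narr s a (neval s i)
  | NAdd e1 e2 => (neval s e1 + neval s e2)%N
  | NSub e1 e2 => (neval s e1 - neval s e2)%N
  end.

Fixpoint reval s (e : rexp) : R :=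
  match e with
  | ROfNat e1 => (neval s e1)%:R
  | RVar x => rvar s x
  | RGet a i => rarr s a (neval s i)
  | RAdd e1 e2 => reval s e1 + reval s e2
  | RSub e1 e2 => reval s e1 - reval s e2
  | RMul e1 e2 => reval s e1 * reval s e2
  | RDiv e1 e2 => reval s e1 / reval s e2
  end.

Fixpoint beval s (b : bexp) : bool :=
  match b with
  | NEq e1 e2 => neval s e1 == neval s e2
  | NLe e1 e2 => (neval s e1 <= neval s e2)%N
  | REq e1 e2 => reval s e1 == reval s e2
  | RLe e1 e2 => reval s e1 <= reval s e2
  | BNot b1 => ~~ beval s b1
  | BAnd b1 b2 => beval s b1 && beval s b2
  end.

Definition set_nvar s x v :=
  State (upd (nvar s) x v) (narr s) (rvar s) (rarr s).
Definition set_narr s a i v :=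
  State (nvar s) (upd (narr s) a (upd (narr s a) i v)) (rvar s) (rarr s).
Definition set_rvar s x v :=
  State (nvar s) (narr s) (upd (rvar s) x v) (rarr s).
Definition set_rarr s a i v :=
  State (nvar s) (narr s) (rvar s) (upd (rarr s) a (upd (rarr s a) i v)).

End Semantics.

(** The cost of an expression is its number of nodes: one unit per constant,
    memory access, arithmetic operation, comparison and connective. *)
Fixpoint ncost (e : nexp) : nat :=
  match e with
  | NConst _ | NVar _ => 1
  | NGet _ i => (ncost i).+1
  | NAdd e1 e2 | NSub e1 e2 => (ncost e1 + ncost e2).+1
  end.

Fixpoint rcost (e : rexp) : nat :=
  match e with
  | ROfNat e1 => (ncost e1).+1
  | RVar _ => 1
  | RGet _ i => (ncost i).+1
  | RAdd e1 e2 | RSub e1 e2 | RMul e1 e2 | RDiv e1 e2 =>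
      (rcost e1 + rcost e2).+1
  end.

Fixpoint bcost (b : bexp) : nat :=
  match b with
  | NEq e1 e2 | NLe e1 e2 => (ncost e1 + ncost e2).+1
  | REq e1 e2 | RLe e1 e2 => (rcost e1 + rcost e2).+1
  | BNot b1 => (bcost b1).+1
  | BAnd b1 b2 => (bcost b1 + bcost b2).+1
  end.

(** [exec c s t s']: started in [s], program [c] terminates in [s'] after [t]
    elementary steps. *)
Inductive exec (R : realType) : com -> state R -> nat -> state R -> Prop :=
  | ExecSkip s : exec Skip s 1 s
  | ExecNSet s x e :
      exec (NSet x e) s (ncost e).+1 (set_nvar s x (neval s e))
  | ExecNPut s a i e :
      exec (NPut a i e) s (ncost i + ncost e).+1
           (set_narr s a (neval s i) (neval s e))
  | ExecRSet s x e :
      exec (RSet x e) s (rcost e).+1 (set_rvar s x (reval s e))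
  | ExecRPut s a i e :
      exec (RPut a i e) s (ncost i + rcost e).+1
           (set_rarr s a (neval s i) (reval s e))
  | ExecSeq s1 s2 s3 c1 c2 t1 t2 :
      exec c1 s1 t1 s2 -> exec c2 s2 t2 s3 ->
      exec (Seq c1 c2) s1 (t1 + t2) s3
  | ExecIf s s' b c1 c2 t :
      exec (if beval s b then c1 else c2) s t s' ->
      exec (If b c1 c2) s (bcost b + t).+1 s'
  | ExecWhileFalse s b c :
      beval s b = false -> exec (While b c) s (bcost b).+1 s
  | ExecWhileTrue s1 s2 s3 b c t1 t2 :
      beval s1 b = true -> exec c s1 t1 s2 -> exec (While b c) s2 t2 s3 ->
      exec (While b c) s1 (bcost b + t1 + t2).+1 s3.

(** * Input and output conventions *)

(** Natural variables 0 and 1 hold [n] and [m], natural array 0 the sizes, and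
    real arrays 0, 1, 2 the works, release times and deadlines.  All other
    memory is zero. *)
Definition input (R : realType) (n m : nat) (I : instance R n m) : state R :=
  let tab (T : Type) (z : T) (f : 'I_n -> T) (k : nat) : T :=
    if insub k is Some j then f j else z in
  {| nvar := nth 0%N [:: n; m];
     narr := nth (fun=> 0%N) [:: tab nat 0%N (jsize I)];
     rvar := fun=> 0;
     rarr := nth (fun=> 0) [:: tab R 0 (work I); tab R 0 (release I);
                               tab R 0 (deadline I)] |}.

(** The schedule is returned as two lists of records.  Natural variable 2 is
    the number of execution records; record [k] says that job [narr 1 k] runs
    during [rarr 3 k <= t < rarr 4 k] at speed [rarr 5 k].  Natural variable 3
    is the number of processor records; record [k] says that the [narr 4 k]
    consecutive processors starting from number [narr 3 k] belong to job
    [narr 2 k].  Blocks of consecutive processors are needed because an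
    explicit list of all [\sum_j jsize j] allotted processors is not of length
    polynomial in [n]. *)
Definition output (R : realType) (n m : nat) (s : state R) : schedule R n m :=
  {| procs := fun j => [set p : 'I_m | [exists k : 'I_(nvar s 3),
       (narr s 2 k == j) && (narr s 3 k <= p < narr s 3 k + narr s 4 k)%N]]%SET;
     speed := fun j t => \sum_(k < nvar s 2 |
       (narr s 1 k == j) && (rarr s 3 k <= t < rarr s 4 k)) rarr s 5 k |}.

(* Main.v *)
Require Import Defs.
From HB Require Import structures.
From mathcomp Require Import all_boot all_order all_algebra.
From mathcomp Require Import all_classical all_reals all_analysis.
From mathcomp Require Import measurable_realfun ring lra zify.
Import Order.TTheory GRing.Theory Num.Theory.
Import numFieldNormedType.Exports.
Local Open Scope ring_scope.

Set Implicit Arguments.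
Unset Strict Implicit.
Unset Printing Implicit Defensive.

(* Let [D = d - r].  The relaxation that only asks for durations [p_j <= D] with
   [\sum_j size_j p_j <= m D] bounds the optimum from below.  By the tangent line
   inequality it is solved by running job [j] at speed [max (W_j / D, v)] for a
   common [v], and [j] is one of the jobs with [p_j = D] exactly when
   [\sum_i size_i min (W_i, W_j) <= m W_j], a condition which is tested without
   taking roots.

   Multiply these durations by [m / (2 m - 1)] and schedule the jobs greedily,
   always starting a largest job that fits.  While a job of size [q] waits, more
   than [m - q] processors are busy, because it does not fit, and at least [q],
   because some running job is at least as large.  Comparing with the total area,
   every job finishes by [d].  Speeds have grown by the factor [2 - 1/m], hence the
   energy by its power [alpha - 1].

   Starting a job cuts at most one block of consecutive processors in two, so at
   most [n + 1] blocks occur, and each of the at most [2 n] starts and time advances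
   takes linear time. *)

(** One algorithm serves both problems because the lower bound ignores interruptions while the
    schedule built has none. The lower bound is weak duality: [v] prices processor time, the excess
    of a job's speed over [v] prices its window, and the relaxed durations satisfy complementary
    slackness. These durations do not depend on [alpha], which is why a machine with field
    operations only can compute them. The factor 2 - 1/m is Graham's: durations at most D and area
    at most m D give a greedy schedule of length at most (2 - 1/m) D, the extreme case being a
    waiting job of size 1, which keeps all m processors busy. The scale m / (2 m - 1) is its
    inverse. The obstacle is a running time independent of m: processors cannot be handled one by
    one, so both the free ones and the allotted ones are kept as blocks, and idle processors are
    counted rather than listed. Sorting is avoided: each event rescans all jobs, which the quadratic
    bound allows. *)

(** * Running time of structured programs *)

Fixpoint loopfree (c : com) : bool :=
  match c with
  | Seq c1 c2 | If _ c1 c2 => loopfree c1 && loopfree c2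
  | While _ _ => false
  | _ => true
  end.

(** Meant for [loopfree] programs; the value at [While] is a mere default, here and in [ccost]. *)
Fixpoint den (R : realType) (c : com) (s : state R) : state R :=
  match c with
  | Skip | While _ _ => s
  | NSet x e => set_nvar s x (neval s e)
  | NPut a i e => set_narr s a (neval s i) (neval s e)
  | RSet x e => set_rvar s x (reval s e)
  | RPut a i e => set_rarr s a (neval s i) (reval s e)
  | Seq c1 c2 => den c2 (den c1 s)
  | If b c1 c2 => if beval s b then den c1 s else den c2 s
  end.

Fixpoint ccost (c : com) : nat :=
  match c with
  | Skip | While _ _ => 1
  | NSet _ e => (ncost e).+1
  | NPut _ i e => (ncost i + ncost e).+1
  | RSet _ e => (rcost e).+1
  | RPut _ i e => (ncost i + rcost e).+1
  | Seq c1 c2 => ccost c1 + ccost c2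
  | If b c1 c2 => (bcost b + maxn (ccost c1) (ccost c2)).+1
  end.

(* Memory cells are tagged 0, 1, 2, 3 for natural variables, natural arrays,
   real variables and real arrays. *)
Fixpoint writes (c : com) : seq (nat * nat) :=
  match c with
  | Skip => [::]
  | NSet x _ => [:: (0, x)]
  | NPut a _ _ => [:: (1, a)]
  | RSet x _ => [:: (2, x)]
  | RPut a _ _ => [:: (3, a)]
  | Seq c1 c2 | If _ c1 c2 => writes c1 ++ writes c2
  | While _ c1 => writes c1
  end%N.

(** Since [writes] computes, preservation of a cell with a literal name is proved by [isT]. *)
Definition frame (R : realType) (c : com) (s s' : state R) : Prop :=
  [/\ forall x, (0, x)%N \notin writes c -> nvar s' x = nvar s x,
      forall a, (1, a)%N \notin writes c -> narr s' a = narr s a,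
      forall x, (2, x)%N \notin writes c -> rvar s' x = rvar s x
    & forall a, (3, a)%N \notin writes c -> rarr s' a = rarr s a].

Definition spec (R : realType) (c : com) (s : state R) (B : nat)
    (Q : state R -> Prop) : Prop :=
  exists t s', [/\ exec c s t s', (t <= B)%N & Q s'].

Definition For (x h : nat) (c : com) : com :=
  Seq (NSet x (NConst 0))
    (While (NLe (NAdd (NVar x) (NConst 1)) (NVar h))
       (Seq c (NSet x (NAdd (NVar x) (NConst 1))))).

Lemma updE (T : Type) (f : nat -> T) (x : nat) (v : T) : upd f x v x = v.
Proof. by rewrite /upd eqxx. Qed.

Lemma updN (T : Type) (f : nat -> T) (x y : nat) (v : T) :
  y != x -> upd f x v y = f y.
Proof. by rewrite /upd => /negbTE ->. Qed.

Lemma frame_refl (R : realType) (c : com) (s : state R) : frame c s s.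
Proof. by split. Qed.

Lemma exec_frame (R : realType) (c : com) (s s' : state R) (t : nat) :
  exec c s t s' -> frame c s s'.
Proof.
elim=> {c s t s'}; try by move=> *; exact: frame_refl.
- by move=> s x e; split=> //= y; rewrite inE => yx; rewrite updN //;
    apply: contraNneq yx => ->.
- by move=> s x i e; split=> //= y; rewrite inE => yx; rewrite updN //;
    apply: contraNneq yx => ->.
- by move=> s x e; split=> //= y; rewrite inE => yx; rewrite updN //;
    apply: contraNneq yx => ->.
- by move=> s x i e; split=> //= y; rewrite inE => yx; rewrite updN //;
    apply: contraNneq yx => ->.
- move=> s1 s2 s3 c1 c2 t1 t2 _ [a1 b1 d1 e1] _ [a2 b2 d2 e2].
  by split=> /= x; rewrite mem_cat negb_or => /andP[x1 x2];
    rewrite ?(a2, b2, d2, e2, a1, b1, d1, e1).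
- move=> s s' b c1 c2 t _; case: ifP => _ [a1 b1 d1 e1];
  by split=> /= x; rewrite mem_cat negb_or => /andP[x1 x2];
    rewrite ?(a1, b1, d1, e1).
- move=> s1 s2 s3 b c t1 t2 _ _ [a1 b1 d1 e1] _ [a2 b2 d2 e2].
  split=> /= x xc.
  + by rewrite a2 ?a1.
  + by rewrite b2 ?b1.
  + by rewrite d2 ?d1.
  + by rewrite e2 ?e1.
Qed.

Lemma frame_sub (R : realType) (c c' : com) (s s' : state R) :
  {subset writes c <= writes c'} -> frame c s s' -> frame c' s s'.
Proof.
move=> cc' [a b d e]; split=> x xc; [apply: a|apply: b|apply: d|apply: e];
by apply: contra xc; exact: cc'.
Qed.

Lemma frame_trans (R : realType) (c : com) (s1 s2 s3 : state R) :
  frame c s1 s2 -> frame c s2 s3 -> frame c s1 s3.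
Proof.
move=> [a1 b1 d1 e1] [a2 b2 d2 e2]; split=> x xc.
- by rewrite a2 ?a1.
- by rewrite b2 ?b1.
- by rewrite d2 ?d1.
- by rewrite e2 ?e1.
Qed.

Lemma spec_frame (R : realType) (c : com) (s : state R) (B : nat)
    (Q : state R -> Prop) :
  spec c s B (fun s' => frame c s s' -> Q s') -> spec c s B Q.
Proof.
move=> [t [s' [ex tB Qs']]]; exists t, s'; split => //.
by apply: Qs'; apply: exec_frame ex.
Qed.

Lemma spec_weaken (R : realType) (c : com) (s : state R) (B B' : nat)
    (Q Q' : state R -> Prop) :
  spec c s B Q -> (B <= B')%N -> (forall s', Q s' -> Q' s') ->
  spec c s B' Q'.
Proof.
move=> [t [s' [ex tB Qs']]] BB' QQ'; exists t, s'; split => //.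
- exact: leq_trans BB'.
- exact: QQ'.
Qed.

Lemma spec_le (R : realType) (c : com) (s : state R) (B B' : nat)
    (Q : state R -> Prop) : spec c s B Q -> (B <= B')%N -> spec c s B' Q.
Proof. by move=> sp BB'; apply: spec_weaken sp BB' _. Qed.

Lemma spec_loopfree (R : realType) (c : com) (s : state R) (Q : state R -> Prop) :
  loopfree c -> Q (den c s) -> spec c s (ccost c) Q.
Proof.
move=> lc Qs; suff [t [ex tc]] : exists t, exec c s t (den c s) /\ (t <= ccost c)%N.
  by exists t, (den c s).
elim: c lc s {Q Qs} => //=.
- by move=> _ s; exists 1%N; split => //; exact: ExecSkip.
- by move=> x e _ s; exists (ncost e).+1; split => //; exact: ExecNSet.
- by move=> a i e _ s; eexists; split; [exact: ExecNPut|].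
- by move=> x e _ s; eexists; split; [exact: ExecRSet|].
- by move=> a i e _ s; eexists; split; [exact: ExecRPut|].
- move=> c1 IH1 c2 IH2 /andP[l1 l2] s.
  have [t1 [ex1 b1]] := IH1 l1 s.
  have [t2 [ex2 b2]] := IH2 l2 (den c1 s).
  by exists (t1 + t2)%N; split; [exact: ExecSeq ex1 ex2|exact: leq_add].
- move=> b c1 IH1 c2 IH2 /andP[l1 l2] s.
  have [t1 [ex1 b1]] := IH1 l1 s.
  have [t2 [ex2 b2]] := IH2 l2 s.
  case: ifP => bs.
  + exists (bcost b + t1).+1; split; first by apply: ExecIf; rewrite bs.
    by rewrite ltnS leq_add2l leq_max b1.
  + exists (bcost b + t2).+1; split; first by apply: ExecIf; rewrite bs.
    by rewrite ltnS leq_add2l leq_max b2 orbT.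
Qed.

Lemma spec_seq (R : realType) (c1 c2 : com) (s : state R) (B1 B2 : nat)
    (Q : state R -> Prop) :
  spec c1 s B1 (fun s1 => spec c2 s1 B2 Q) ->
  spec (Seq c1 c2) s (B1 + B2) Q.
Proof.
move=> [t1 [s1 [ex1 b1 [t2 [s2 [ex2 b2 Qs]]]]]].
by exists (t1 + t2)%N, s2; split => //; [exact: ExecSeq ex1 ex2|exact: leq_add].
Qed.

Lemma spec_if (R : realType) (b : bexp) (c1 c2 : com) (s : state R) (B : nat)
    (Q : state R -> Prop) :
  spec (if beval s b then c1 else c2) s B Q ->
  spec (If b c1 c2) s (bcost b + B).+1 Q.
Proof.
move=> [t [s' [ex tB Qs]]]; exists (bcost b + t).+1, s'; split => //.
- exact: ExecIf.
- by rewrite ltnS leq_add2l.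
Qed.

(** Besides the body, a round costs 5 for the test, 4 for the increment and 1 for the loop, hence
    [B + 10]; initialisation costs 2 and the last, failing test 6, hence 8. The frame is handed to
    each round, so [Inv] need only mention cells that the loop writes. *)
Lemma spec_for (R : realType) (x h : nat) (c : com) (s : state R) (B : nat)
    (Inv : nat -> state R -> Prop) (Q : state R -> Prop) :
  x != h -> (0, x)%N \notin writes c -> (0, h)%N \notin writes c ->
  Inv 0%N (set_nvar s x 0%N) ->
  (forall k s1, (k < nvar s h)%N -> nvar s1 x = k -> frame (For x h c) s s1 ->
     Inv k s1 -> spec c s1 B (fun s2 => Inv k.+1 (set_nvar s2 x k.+1))) ->
  (forall s1, frame (For x h c) s s1 -> Inv (nvar s h) s1 -> Q s1) ->
  spec (For x h c) s (nvar s h * (B + 10) + 8) Q.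
Proof.
move=> xh xc hc Inv0 step final.
pose W := While (NLe (NAdd (NVar x) (NConst 1)) (NVar h))
       (Seq c (NSet x (NAdd (NVar x) (NConst 1)))).
have hF : (0, h)%N \notin writes (For x h c).
  rewrite /= !inE mem_cat !inE !xpair_eqE /= (eq_sym h) (negbTE xh) /=.
  by rewrite (negbTE hc).
have loop k s1 : (k <= nvar s h)%N -> nvar s1 x = (nvar s h - k)%N ->
    frame (For x h c) s s1 -> Inv (nvar s h - k)%N s1 ->
    spec W s1 (k * (B + 10) + 6) Q.
  elim: k s1 => [|k IH] s1 kn s1x fr Is1.
    exists 6%N, s1; split => //; last by apply: final => //; rewrite subn0 in Is1.
    apply: ExecWhileFalse => /=; case: fr => fnv _ _ _.
    by rewrite s1x fnv // subn0 addn1 ltnn.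
  have hs1 : nvar s1 h = nvar s h by case: fr => fnv _ _ _; rewrite fnv.
  have lt1 : (nvar s h - k.+1 < nvar s h)%N by lia.
  have [t1 [s2 [ex1 b1 Is2]]] := step _ _ lt1 s1x fr Is1.
  have fr1 := exec_frame ex1.
  have s2x : nvar s2 x = nvar s1 x by case: fr1 => fnv _ _ _; rewrite fnv.
  set s3 := set_nvar s2 x (nvar s h - k.+1).+1 in Is2.
  have fr3 : frame (For x h c) s s3.
    apply: frame_trans fr _; apply: (frame_trans (s2 := s2)).
      apply: frame_sub fr1 => y yc /=.
      by rewrite !inE mem_cat yc orbT.
    split=> //= y; rewrite !inE => yx; rewrite updN //.
    by apply: contraNneq yx => ->; rewrite eqxx.
  have ek : (nvar s h - k.+1).+1 = (nvar s h - k)%N by lia.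
  have [t3 [s4 [ex3 b3 Qs4]]] : spec W s3 (k * (B + 10) + 6) Q.
    apply: IH => //; first by lia.
      by rewrite /= updE ek.
    by rewrite -ek.
  exists (5 + (t1 + 4) + t3).+1, s4; split => //; last by lia.
  apply: (ExecWhileTrue (s2 := s3)) => //.
    by rewrite /= s1x hs1 addn1; lia.
  apply: ExecSeq; first exact: ex1.
  have -> : s3 = set_nvar s2 x (neval s2 (NAdd (NVar x) (NConst 1))).
    by rewrite /s3 /= s2x s1x addn1.
  exact: (ExecNSet s2 x (NAdd (NVar x) (NConst 1))).
have [t [s' [ex tb Qs']]] : spec W (set_nvar s x 0%N) (nvar s h * (B + 10) + 6) Q.
  apply: loop => //; rewrite ?subnn //=; first by rewrite updE.
  split=> //= y; rewrite !inE => yx; rewrite updN //.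
  by apply: contraNneq yx => ->; rewrite eqxx.
exists (2 + t)%N, s'; split => //; last by lia.
apply: ExecSeq ex; exact: (ExecNSet s x (NConst 0)).
Qed.

(** * The relaxed problem *)

Section Durations.
Variables (R : realType) (n m : nat) (q : nat -> nat) (W : nat -> R) (D : R).

(** Running every job [i] at speed max(W_i, W_j) / D takes D / W_j times the left-hand side as area.
    The test thus asks whether the common speed W_j / D already respects the area m D, that is,
    whether the optimal one is at most W_j / D. *)
Definition saturated (j : nat) : bool :=
  \sum_(i < n) (q i)%:R * Num.min (W i) (W j) <= m%:R * W j.

Definition free_work : R := \sum_(i < n | ~~ saturated i) (q i)%:R * W i.

Definition free_procs : R := m%:R - \sum_(i < n | saturated i) (q i)%:R.

(** The speed at which the unsaturated jobs exactly fill the area that the saturated ones leave; it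
    is 0 if all jobs are saturated. *)
Definition opt_speed : R := free_work / (free_procs * D).

Definition opt_dur (j : nat) : R := if saturated j then D else W j / opt_speed.

Hypothesis D0 : 0 < D.
Hypothesis W0 : forall j, (j < n)%N -> 0 < W j.
Hypothesis q0 : forall j, (j < n)%N -> (0 < q j <= m)%N.

(** The quotient min(w, x) / x is nonincreasing in x, so the test weakens as x grows from W_j to
    W_i. *)
Lemma saturated_up (i j : nat) : (i < n)%N -> (j < n)%N ->
  saturated j -> W j <= W i -> saturated i.
Proof.
move=> i_n j_n; rewrite /saturated => sj Wji.
have Wj := W0 j_n; have Wi := W0 i_n.
rewrite -(ler_pM2l Wj) mulr_sumr.
apply: (@le_trans _ _ (W i * (m%:R * W j))); last first.
  by rewrite mulrCA (mulrC (W i)) (mulrCA (W j)).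
apply: le_trans (_ : _ <= W i * \sum_(k < n) (q k)%:R * Num.min (W k) (W j)) _;
  last by rewrite ler_pM2l.
rewrite mulr_sumr; apply: ler_sum => k _; rewrite !(mulrCA _ (q k)%:R).
rewrite ler_wpM2l //; have Wk := W0 (ltn_ord k).
by case: (leP (W k) (W i)) => ki; case: (leP (W k) (W j)) => kj; nra.
Qed.

Lemma free_work_ge0 : 0 <= free_work.
Proof. by apply: sumr_ge0 => i _; rewrite mulr_ge0 // ltW // W0. Qed.

(** By [saturated_up] no unsaturated job is heavier than the lightest saturated job [k]. Every
    minimum in the test for [k] is therefore known, W_k on saturated jobs and W_i on the others, and
    the test becomes the claimed inequality for [k]. *)
Lemma saturated_free (j : nat) : (j < n)%N -> saturated j ->
  0 <= free_procs /\ free_work <= free_procs * W j.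
Proof.
move=> j_n sj.
have [k sk kmin] := @arg_minP _ _ _ (Ordinal j_n)
  (fun i : 'I_n => saturated i) (fun i : 'I_n => W i) sj.
have Wk := W0 (ltn_ord k).
have key : free_work <= free_procs * W k.
  have := sk; rewrite /saturated (bigID (fun i : 'I_n => saturated i)) /= => sk'.
  rewrite mulrBl lerBrDl; apply: le_trans sk'; apply: lerD.
    rewrite mulr_suml; apply: ler_sum => i si.
    by rewrite ler_wpM2l // le_min lexx (kmin i).
  apply: ler_sum => i si; rewrite ler_wpM2l // le_min lexx /=.
  by case: (leP (W i) (W k)) => // /ltW /(saturated_up (ltn_ord i) (ltn_ord k) sk);
    rewrite (negbTE si).
have M0 : 0 <= free_procs.
  by have := le_trans free_work_ge0 key; rewrite pmulr_lge0.
split=> //; apply: le_trans key _; rewrite ler_wpM2l //.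
exact: (kmin (Ordinal j_n)).
Qed.

(** The failing test of the heaviest unsaturated job [k] gives the strict inequality once each
    minimum is bounded by W_k on saturated jobs and by W_i on the others. *)
Lemma unsaturated_free (j : nat) : (j < n)%N -> ~~ saturated j ->
  [/\ 0 < free_procs, 0 < free_work & free_procs * W j < free_work].
Proof.
move=> j_n sj.
have [k sk kmax] := @arg_maxP _ _ _ (Ordinal j_n)
  (fun i : 'I_n => ~~ saturated i) (fun i : 'I_n => W i) sj.
have Wk := W0 (ltn_ord k); have Wj := W0 j_n.
have N0 : 0 < free_work.
  rewrite /free_work (bigD1 (Ordinal j_n)) //=; apply: ltr_pwDl.
    by rewrite mulr_gt0 // ltr0n; case/andP: (q0 j_n).
  by apply: sumr_ge0 => i _; rewrite mulr_ge0 // ltW // W0.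
have M0 : 0 < free_procs.
  case: (pselect (exists i : 'I_n, saturated i)) => [[i si]|nex].
    have [M0 M1] := saturated_free (ltn_ord i) si.
    rewrite lt_neqAle M0 andbT eq_sym; apply: contraTneq N0 => M2.
    by rewrite -leNgt (le_trans M1) // M2 mul0r.
  rewrite /free_procs big_pred0; last first.
    by move=> i; apply/negP => si; apply: nex; exists i.
  by rewrite subr0 ltr0n; case/andP: (q0 j_n) => /leq_trans; apply.
split=> //.
apply: (@le_lt_trans _ _ (free_procs * W k)).
  by rewrite ler_pM2l //; exact: (kmax (Ordinal j_n)).
have := sk; rewrite /saturated -ltNge (bigID (fun i : 'I_n => saturated i)) /= => sk'.
rewrite mulrBl ltrBlDl; apply: lt_le_trans sk' _; apply: lerD.
  rewrite mulr_suml; apply: ler_sum => i si.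
  by rewrite ler_wpM2l // ge_min lexx orbT.
by apply: ler_sum => i si; rewrite ler_wpM2l // ge_min lexx.
Qed.

Lemma opt_speed_ge0 : 0 <= opt_speed.
Proof.
case: (pselect (exists2 j : nat, (j < n)%N & ~~ saturated j)) => [[j j_n sj]|nex].
  by have [M0 N0 _] := unsaturated_free j_n sj; rewrite ltW // divr_gt0 ?mulr_gt0.
rewrite /opt_speed /free_work big_pred0 ?mul0r // => i.
by apply/negbTE/negP => si; apply: nex; exists i => //; exact: ltn_ord.
Qed.

(** Together with [opt_dur_area] these are the complementary slackness conditions: a job shorter
    than the window runs at the common speed, and the area is exhausted unless that speed is 0. *)
Lemma opt_durP (j : nat) : (j < n)%N ->
  [/\ 0 < opt_dur j, opt_dur j <= D, opt_speed <= W j / opt_dur j &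
      opt_dur j != D -> W j / opt_dur j = opt_speed].
Proof.
move=> j_n; have Wj := W0 j_n; rewrite /opt_dur; case: ifPn => sj.
  split; rewrite ?eqxx //.
  have [M0 M1] := saturated_free j_n sj.
  rewrite ler_pdivlMr // /opt_speed invfM mulrA divfK ?gt_eqF //.
  (* If the saturated jobs occupy all processors, [free_procs] is 0, and so is the quotient because
     [0^-1 = 0]. *)
  move: M0; rewrite le_eqVlt => /predU1P[<-|M0]; first by rewrite invr0 mulr0 ltW.
  by rewrite ler_pdivrMr // mulrC.
have [M0 N0 M1] := unsaturated_free j_n sj.
have v0 : 0 < opt_speed by rewrite divr_gt0 ?mulr_gt0.
have e : W j / (W j / opt_speed) = opt_speed.
  by rewrite invf_div mulrCA divff ?mulr1 // gt_eqF.
split; rewrite ?e //; first exact: divr_gt0.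
rewrite ler_pdivrMr // /opt_speed invfM mulrCA (mulrCA D) divff ?gt_eqF // mulr1.
by rewrite ler_pdivlMr // mulrC ltW.
Qed.

Lemma opt_dur_area : (0 < n)%N ->
  \sum_(j < n) (q j)%:R * opt_dur j <= m%:R * D /\
  (opt_speed != 0 -> \sum_(j < n) (q j)%:R * opt_dur j = m%:R * D).
Proof.
move=> n0; rewrite (bigID (fun i : 'I_n => saturated i)) /=.
have -> : \sum_(i < n | saturated i) (q i)%:R * opt_dur i = (m%:R - free_procs) * D.
  rewrite /free_procs opprB addrCA subrr addr0 mulr_suml.
  by apply: eq_bigr => i si; rewrite /opt_dur si.
have -> : \sum_(i < n | ~~ saturated i) (q i)%:R * opt_dur i = free_work / opt_speed.
  rewrite /free_work mulr_suml.
  by apply: eq_bigr => i si; rewrite /opt_dur (negbTE si) mulrA.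
case: (pselect (exists2 j : nat, (j < n)%N & ~~ saturated j)) => [[j j_n sj]|nex].
  have [M0 N0 _] := unsaturated_free j_n sj.
  have -> : free_work / opt_speed = free_procs * D.
    by rewrite /opt_speed invf_div mulrCA divff ?mulr1 // gt_eqF.
  by rewrite -mulrDl subrK.
have all_sat (i : 'I_n) : saturated i.
  by apply: contrapT => /negP si; apply: nex; exists i => //; exact: ltn_ord.
have N0 : free_work = 0 by rewrite /free_work big_pred0 // => i; rewrite all_sat.
rewrite /opt_speed N0 !mul0r addr0 eqxx; split => //.
rewrite ler_pM2r // lerBlDr lerDl.
by have [] := saturated_free n0 (all_sat (Ordinal n0)).
Qed.

End Durations.

(** * Energy of feasible schedules *)

Lemma measurable_sum_cond (d : measure_display) (T : measurableType d)
    (R : realType) (D : set T) (I : finType) (P : pred I) (h : I -> T -> R) :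
  (forall i, measurable_fun D (h i)) ->
  measurable_fun D (fun x => \sum_(i | P i) h i x).
Proof.
move=> mh; rewrite (_ : (fun x => _) =
  fun x => \sum_(i <- [seq i <- index_enum I | P i]) h i x); last first.
  by apply/funext => x; rewrite big_filter.
exact: measurable_sum.
Qed.

(** Young's inequality for x and c^(alpha - 1) with the conjugate exponents alpha and alpha / (alpha
    - 1), which spares any derivative. *)
Lemma powR_tangent (R : realType) (alpha c x : R) : 1 < alpha -> 0 < c -> 0 <= x ->
  alpha * c `^ (alpha - 1) * x <= x `^ alpha + (alpha - 1) * c `^ alpha.
Proof.
move=> a1 c0 x0.
have a0 : 0 < alpha by apply: lt_trans a1.
have a1' : 0 < alpha - 1 by rewrite subr_gt0.
have c_pow : (c `^ (alpha - 1)) `^ (alpha / (alpha - 1)) = c `^ alpha.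
  by rewrite -powRrM; congr (_ `^ _); field; rewrite gt_eqF.
have := @conjugate_powR R x (c `^ (alpha - 1)) alpha (alpha / (alpha - 1)) x0
  (powR_ge0 _ _) a0 (divr_gt0 a0 a1').
rewrite c_pow => young.
have {young}/young : alpha^-1 + (alpha / (alpha - 1))^-1 = 1.
  by field; rewrite !gt_eqF.
rewrite -(ler_pM2l a0) mulrA (mulrAC alpha) => young; apply: le_trans young _.
by rewrite le_eqVlt; apply/orP; left; apply/eqP; field; rewrite !gt_eqF.
Qed.

Section FeasibleEnergy.
Variables (R : realType) (n m : nat) (pb : problem) (I : instance R n m).
Variables (S : schedule R n m) (alpha : R).
Hypothesis feas : feasible pb I S.
Hypothesis alpha1 : 1 < alpha.

Lemma proc_speed_executed (p : 'I_m) (j : 'I_n) (t : R) :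
  p \in procs S j -> 0 < speed S j t -> proc_speed S p t = speed S j t.
Proof.
move=> pj jt; rewrite /proc_speed (bigD1 j) //= big1 ?addr0 // => i /andP[pi ij].
apply/eqP; rewrite eq_le (feasible_ge0 feas) andbT leNgt; apply/negP => it.
have := feasible_disjoint feas ij it jt.
by move/pred0P/(_ p); rewrite /= pi pj.
Qed.

Lemma proc_speed_idle (p : 'I_m) (t : R) :
  (forall j, p \in procs S j -> ~ 0 < speed S j t) ->
  forall j, p \in procs S j -> speed S j t = 0.
Proof.
move=> idle j pj; apply/eqP; rewrite eq_le (feasible_ge0 feas) andbT leNgt.
exact/negP/idle.
Qed.

Lemma powR_proc_speed (p : 'I_m) (t : R) :
  proc_speed S p t `^ alpha = \sum_(j < n | p \in procs S j) speed S j t `^ alpha.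
Proof.
have a0 : alpha != 0 by rewrite gt_eqF // (lt_trans _ alpha1).
case: (pselect (exists2 j, p \in procs S j & 0 < speed S j t)) => [[j pj jt]|idle].
  rewrite (proc_speed_executed pj jt) (bigD1 j) //= big1 ?addr0 // => i /andP[pi ij].
  rewrite (_ : speed S i t = 0) ?powR0 //.
  have := proc_speed_executed pj jt; rewrite /proc_speed (bigD1 j) //=.
  rewrite -[RHS]addr0 => /addrI /eqP; rewrite psumr_eq0 => [/allP|*]; last first.
    exact: feasible_ge0 feas _ _.
  by move/(_ i (mem_index_enum _)); rewrite pi ij => /eqP.
have idle' := @proc_speed_idle p t (fun j pj jt => idle (ex_intro2 _ _ j pj jt)).
rewrite /proc_speed !big1 ?powR0 // => j pj; rewrite idle' // powR0 //.
Qed.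

Lemma measurable_proc_speed (p : 'I_m) : measurable_fun setT (proc_speed S p).
Proof.
by apply: measurable_sum_cond => j; exact: feasible_measurable feas j.
Qed.

(** At most one job of [p] runs at [t]; the tangent at its [c j] leaves the error (alpha - 1)
    c_j^alpha. Writing c_j^alpha as v^alpha plus a nonnegative excess, and charging the excess of
    all jobs of [p], makes the error independent of [t] and ready for integration. *)
Lemma proc_speed_tangent (c : 'I_n -> R) (v : R) (p : 'I_m) (t : R) :
  0 <= v -> (forall j, 0 < c j /\ v <= c j) ->
  \sum_(j < n | p \in procs S j) alpha * c j `^ (alpha - 1) * speed S j t <=
  proc_speed S p t `^ alpha + (alpha - 1) *
    (v `^ alpha + \sum_(j < n | p \in procs S j) (c j `^ alpha - v `^ alpha)).
Proof.
move=> v0 cv.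
have a1' : 0 <= alpha - 1 by rewrite subr_ge0 ltW.
have a0 : 0 <= alpha by rewrite (le_trans _ (ltW alpha1)).
have cv' j : 0 <= c j `^ alpha - v `^ alpha.
  have [c0 vc] := cv j; rewrite subr_ge0; apply: ge0_ler_powR; rewrite ?nnegrE //.
  exact: ltW.
case: (pselect (exists2 j, p \in procs S j & 0 < speed S j t)) => [[j pj jt]|idle].
  rewrite (proc_speed_executed pj jt) (bigD1 j) //= big1 ?addr0.
    apply: le_trans (powR_tangent alpha1 (cv j).1 (ltW jt)) _.
    rewrite lerD2l ler_wpM2l // (bigD1 j) //= addrA addrCA subrr addr0 lerDl.
    by apply: sumr_ge0 => i _; exact: cv'.
  move=> i /andP[pi ij]; rewrite (_ : speed S i t = 0) ?mulr0 //.
  have := proc_speed_executed pj jt; rewrite /proc_speed (bigD1 j) //=.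
  rewrite -[RHS]addr0 => /addrI /eqP; rewrite psumr_eq0 => [/allP|*]; last first.
    exact: feasible_ge0 feas _ _.
  by move/(_ i (mem_index_enum _)); rewrite pi ij => /eqP.
have idle' := @proc_speed_idle p t (fun j pj jt => idle (ex_intro2 _ _ j pj jt)).
rewrite big1 => [|j pj]; last by rewrite idle' // mulr0.
by rewrite addr_ge0 ?powR_ge0 // mulr_ge0 // addr_ge0 ?powR_ge0 // sumr_ge0.
Qed.

Lemma sum_procs (V : nmodType) (F : 'I_n -> V) :
  \sum_(p < m) \sum_(j < n | p \in procs S j) F j = \sum_(j < n) F j *+ jsize I j.
Proof.
rewrite (exchange_big_dep predT) //=; apply: eq_bigr => j _.
by rewrite sumr_const (feasible_size feas).
Qed.

(** A dual bound: (alpha - 1) v^alpha is the multiplier of the total area, and (alpha - 1)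
    (c_j^alpha - v^alpha) that of the window of [j] on each of its processors. *)
Lemma energy_ge (c : 'I_n -> R) (v r d : R) :
  (forall j, release I j = r) -> (forall j, deadline I j = d) -> r < d ->
  0 <= v -> (forall j, 0 < c j /\ v <= c j) ->
  ((\sum_(j < n) (jsize I j)%:R * (alpha * c j `^ (alpha - 1) * work I j) -
    (alpha - 1) * (d - r) * (m%:R * v `^ alpha +
       \sum_(j < n) (jsize I j)%:R * (c j `^ alpha - v `^ alpha)))%:E
  <= energy alpha S)%E.
Proof.
move=> rel dl rd v0 cv.
have a1' : 0 <= alpha - 1 by rewrite subr_ge0 ltW.
have a0 : 0 <= alpha by rewrite (le_trans _ (ltW alpha1)).
have cv' j : 0 <= c j `^ alpha - v `^ alpha.
  have [c0 vc] := cv j; rewrite subr_ge0; apply: ge0_ler_powR; rewrite ?nnegrE //.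
  exact: ltW.
pose b (p : 'I_m) := (alpha - 1) *
    (v `^ alpha + \sum_(j < n | p \in procs S j) (c j `^ alpha - v `^ alpha)).
have b0 p : 0 <= b p by rewrite mulr_ge0 // addr_ge0 ?powR_ge0 // sumr_ge0.
pose w j := alpha * c j `^ (alpha - 1) * work I j.
have ac0 j : 0 <= alpha * c j `^ (alpha - 1) by rewrite mulr_ge0 ?powR_ge0.
have mrd : measurable (`[r, d[%classic : set R) by exact: measurable_itv.
have per_proc (p : 'I_m) : ((\sum_(j < n | p \in procs S j) w j)%:E <=
    (\int[lebesgue_measure]_(t in setT) (proc_speed S p t `^ alpha)%:E)
      + (b p * (d - r))%:E)%E.
  have <- : (\int[lebesgue_measure]_(t in `[r, d[%classic)
      (\sum_(j < n | p \in procs S j) alpha * c j `^ (alpha - 1) * speed S j t)%:E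
      = (\sum_(j < n | p \in procs S j) w j)%:E)%E.
    under eq_integral do rewrite -sumEFin -big_filter.
    rewrite ge0_integral_sum //=.
    - rewrite big_filter -sumEFin; apply: eq_bigr => j _.
      under eq_integral do rewrite EFinM.
      rewrite ge0_integralZl_EFin //.
      + have := feasible_work feas j; rewrite rel dl => ->.
        by rewrite /w EFinM.
      + by move=> t _; rewrite lee_fin (feasible_ge0 feas).
      + apply/measurable_EFinP; apply: measurable_funTS.
        exact: feasible_measurable feas j.
    - move=> j; apply/measurable_EFinP; apply: measurable_funM => //.
      by apply: measurable_funTS; exact: feasible_measurable feas j.
    - by move=> j t _; rewrite lee_fin mulr_ge0 // (feasible_ge0 feas).
  have mpow : measurable_fun setT (fun t => proc_speed S p t `^ alpha).
    apply: (measurableT_comp (measurable_powR alpha)).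
    exact: measurable_proc_speed.
  apply: (@le_trans _ _ (\int[lebesgue_measure]_(t in `[r, d[%classic)
      ((proc_speed S p t `^ alpha)%:E + (b p)%:E))%E).
    apply: ge0_le_integral => //.
    - move=> t _; rewrite lee_fin sumr_ge0 // => j _.
      by rewrite mulr_ge0 // (feasible_ge0 feas).
    - apply/measurable_EFinP; apply: measurable_sum_cond => j; apply: measurable_funM => //.
      by apply: measurable_funTS; exact: feasible_measurable feas j.

    - apply/measurable_EFinP; apply: measurable_funD => //.
      exact: measurable_funTS.
    - move=> t _; rewrite lee_fin; exact: proc_speed_tangent.
  rewrite ge0_integralD //=.
  - apply: leeD.
      apply: ge0_subset_integral => //.
        exact/measurable_EFinP.
      by move=> t _; rewrite lee_fin powR_ge0.
    have /= -> := @integral_cst _ _ R lebesgue_measure _ mrd (b p)%:E.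
    rewrite lebesgue_measure_itv /= lte_fin rd -EFinB -EFinM //.
  - by move=> t _; rewrite lee_fin powR_ge0.
  - by apply/measurable_EFinP; exact: measurable_funTS.
  - by move=> t _; rewrite lee_fin.
have -> : \sum_(j < n) (jsize I j)%:R * (alpha * c j `^ (alpha - 1) * work I j) =
    \sum_(p < m) \sum_(j < n | p \in procs S j) w j.
  by rewrite sum_procs; apply: eq_bigr => j _; rewrite mulr_natl.
have -> : (alpha - 1) * (d - r) * (m%:R * v `^ alpha +
       \sum_(j < n) (jsize I j)%:R * (c j `^ alpha - v `^ alpha)) =
    \sum_(p < m) b p * (d - r).
  rewrite -mulr_suml /b -mulr_sumr big_split /= sumr_const card_ord sum_procs.
  rewrite (mulr_natl (v `^ alpha)) mulrAC; congr (_ * (_ + _) * _).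
  by apply: eq_bigr => j _; rewrite mulr_natl.
rewrite EFinB leeBlDr // -!sumEFin /energy -big_split /=.
by apply: lee_sum => p _; exact: per_proc.
Qed.

Lemma energy_feasible : (energy alpha S =
  \sum_(j < n) (\int[lebesgue_measure]_(t in setT) (speed S j t `^ alpha)%:E) *+ jsize I j)%E.
Proof.
rewrite -sum_procs; apply: eq_bigr => p _.
under eq_integral do rewrite powR_proc_speed -sumEFin -big_filter.
rewrite ge0_integral_sum //= ?big_filter //.
  move=> j; apply/measurable_EFinP.
  apply: (measurableT_comp (measurable_powR alpha)).
  exact: feasible_measurable feas j.
by move=> j t _; rewrite lee_fin powR_ge0.
Qed.

End FeasibleEnergy.

(** At c_j = W_j / p_j the dual bound is tight: either the excess over v^alpha vanishes or p_j is
    the whole window, and either v is 0 or the area is exhausted. What remains is the energy of the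
    relaxed solution. *)
Lemma min_energy_ge (R : realType) (n m : nat) (pb : problem) (I : instance R n m)
    (alpha r d v : R) (p : 'I_n -> R) :
  1 < alpha -> valid_instance I -> r < d ->
  (forall j, release I j = r) -> (forall j, deadline I j = d) -> 0 <= v ->
  (forall j, [/\ 0 < p j, v <= work I j / p j &
     p j != d - r -> work I j / p j = v]) ->
  (v != 0 -> \sum_(j < n) (jsize I j)%:R * p j = m%:R * (d - r)) ->
  ((\sum_(j < n) (jsize I j)%:R * (p j * (work I j / p j) `^ alpha))%:E
   <= min_energy alpha pb I)%E.
Proof.
move=> alpha1 valI rd rel dl v0 pP area.
apply: le_ereal_inf_tmp => _ [S feas <-].
have c0 j : 0 < work I j / p j.
  by have [p0 _ _] := pP j; rewrite divr_gt0 // (valI j).1.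
have := energy_ge (c := fun j => work I j / p j) feas alpha1 rel dl rd v0.
move=> /(_ _)/wrap[]; first by move=> j; split=> //; have [] := pP j.
apply: le_trans; rewrite lee_fin le_eqVlt; apply/orP; left; apply/eqP.
have -> : \sum_(j < n) (jsize I j)%:R *
      (alpha * (work I j / p j) `^ (alpha - 1) * work I j) =
    alpha * \sum_(j < n) (jsize I j)%:R * (p j * (work I j / p j) `^ alpha).
  rewrite mulr_sumr; apply: eq_bigr => j _; have [p0 _ _] := pP j.
  have -> : (work I j / p j) `^ alpha =
      (work I j / p j) `^ (alpha - 1) * (work I j / p j).
    rewrite -[RHS](congr1 _ (powRr1 (ltW (c0 j)))) -powRD ?subrK //.
    by apply/implyP => _; rewrite gt_eqF.
  by field; rewrite gt_eqF.
have -> : (alpha - 1) * (d - r) * (m%:R * v `^ alpha + \sum_(j < n) (jsize I j)%:R *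
      ((work I j / p j) `^ alpha - v `^ alpha)) =
    (alpha - 1) * (m%:R * (d - r) * v `^ alpha + \sum_(j < n) ((jsize I j)%:R *
      (p j * (work I j / p j) `^ alpha) - (jsize I j)%:R * p j * v `^ alpha)).
  rewrite -mulrA; congr (_ * _); rewrite mulrDr; congr (_ + _); first by ring.
  rewrite mulr_sumr; apply: eq_bigr => j _; have [_ _ pd] := pP j.
  have [->|/pd ->] := eqVneq (p j) (d - r); first by ring.
  by rewrite !subrr !mulr0 -mulrA subrr.
rewrite sumrB -mulr_suml.
have [->|/area ->] := eqVneq v 0; last by ring.
by rewrite powR0 ?gt_eqF ?(lt_trans _ alpha1) // !mulr0 subr0 add0r; ring.
Qed.

Lemma energy_steps (R : realType) (n m : nat) (pb : problem) (I : instance R n m)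
    (S : schedule R n m) (alpha : R) (b e c : 'I_n -> R) :
  1 < alpha -> feasible pb I S ->
  (forall j, b j < e j) ->
  (forall j t, speed S j t = if b j <= t < e j then c j else 0) ->
  energy alpha S = (\sum_(j < n) (jsize I j)%:R * ((e j - b j) * c j `^ alpha))%:E.
Proof.
move=> alpha1 feas be sp; rewrite (energy_feasible feas alpha1) -sumEFin.
apply: eq_bigr => j _.
have -> : (\int[lebesgue_measure]_t (speed S j t `^ alpha)%:E =
    ((e j - b j) * c j `^ alpha)%:E)%E.
  have mbe : measurable (`[b j, e j[%classic : set R) by exact: measurable_itv.
  transitivity (\int[lebesgue_measure]_(t in `[b j, e j[%classic) cst (c j `^ alpha)%:E t)%E.
    rewrite [RHS]integral_mkcond; apply: eq_integral => t _.
    rewrite sp /patch mem_setE in_itv /=; case: ifP => // _.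
    by rewrite powR0 // gt_eqF // (lt_trans _ alpha1).
  rewrite integral_cst //= lebesgue_measure_itv /= lte_fin be -EFinB -EFinM.
  by rewrite mulrC.
by rewrite -EFin_natmul mulr_natl.
Qed.

(** * Greedy scheduling *)

Lemma big_ord_update (T : Type) (idx : T) (op : Monoid.com_law idx) (n j : nat)
    (P P' : pred nat) (F F' : nat -> T) :
  (j < n)%N -> ~~ P j ->
  (forall i, (i < n)%N -> i != j -> P' i = P i /\ F' i = F i) ->
  \big[op/idx]_(i < n | P' i) F' i =
    op (if P' j then F' j else idx) (\big[op/idx]_(i < n | P i) F i).
Proof.
move=> j_n nPj eqPF; rewrite big_mkcond [in RHS]big_mkcond /=.
rewrite !(bigD1 (Ordinal j_n) isT) /= (negbTE nPj) Monoid.mul1m; congr (op _ _).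
apply: eq_bigr => i ij.
have inj : val i != j by apply: contraNneq ij => ij; apply/eqP/val_inj.
by have [-> ->] := eqPF i (ltn_ord i) inj.
Qed.

Section Greedy.
Variables (R : realType) (n m : nat) (q : nat -> nat) (p : nat -> R) (r : R).
Hypothesis q0 : forall j, (j < n)%N -> (0 < q j <= m)%N.
Hypothesis p0 : forall j, (j < n)%N -> 0 < p j.

Definition started (done : nat -> nat) (j : nat) : bool := done j == 1%N.

Definition running (t : R) (done : nat -> nat) (e : nat -> R) (j : nat) : bool :=
  started done j && (t < e j).

Definition busy (t : R) (done : nat -> nat) (e : nat -> R) : nat :=
  \sum_(i < n | running t done e i) q i.

Definition work_done (t : R) (done : nat -> nat) (b : nat -> R) : R :=
  \sum_(i < n | started done i) (q i)%:R * Num.min (p i) (t - b i).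

Definition min_busy (j : nat) : nat := maxn (q j) (m.+1 - q j).

(** The last two fields concern every waiting job. [greedy_work] accumulates over time the lower
    bound [min_busy] on busy processors, and [greedy_fit] is what keeps that bound valid at each
    instant when the job does not fit. *)
Record greedy_inv (t d : R) (done : nat -> nat) (b e : nat -> R) : Prop := GreedyInv {
  greedy_t : r <= t;
  greedy_started : forall j, (j < n)%N -> started done j ->
    [/\ r <= b j, b j <= t, e j = b j + p j & e j <= d];
  greedy_busy : (busy t done e <= m)%N;
  greedy_fit : forall j, (j < n)%N -> ~~ started done j ->
    (\sum_(i < n | running t done e i && (q i < q j)) q i + q j <= m)%N;
  greedy_work : forall j, (j < n)%N -> ~~ started done j ->
    (t - r) * (min_busy j)%:R <= work_done t done b }.

(* Some running job is at least as large as [j], for otherwise [greedy_fit]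
   would leave room for [j]. *)
Lemma min_busy_le (t d : R) (done : nat -> nat) (b e : nat -> R) (j : nat) :
  greedy_inv t d done b e -> (j < n)%N -> ~~ started done j ->
  (m - busy t done e < q j)%N -> (min_busy j <= busy t done e)%N.
Proof.
move=> inv j_n nj nofit; have bm := greedy_busy inv.
have bq : (m.+1 - q j <= busy t done e)%N by lia.
rewrite geq_max bq andbT.
have := greedy_fit inv j_n nj.
case: (pselect (exists i : 'I_n, running t done e i && (q j <= q i)%N)) => [[i /andP[ri qij]]|nex].
  by move=> _; rewrite /busy (bigD1 i) //= (leq_trans qij) // leq_addr.
rewrite (eq_bigl (fun i : 'I_n => running t done e i)); last first.
  move=> i; apply: andb_idr => ri; rewrite ltnNge; apply/negP => qij.
  by apply: nex; exists i; rewrite ri.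
by rewrite -/(busy t done e); lia.
Qed.

(** No running job ends before [t'], so the area processed grows by [t' - t] times the number of
    busy processors, which is at least [min_busy j] for each waiting [j] since none fits. *)
Lemma greedy_advance (t t' d : R) (done : nat -> nat) (b e : nat -> R) :
  greedy_inv t d done b e -> t <= t' ->
  (forall j, (j < n)%N -> running t done e j -> t' <= e j) ->
  (forall j, (j < n)%N -> ~~ started done j -> (m - busy t done e < q j)%N) ->
  greedy_inv t' d done b e.
Proof.
move=> inv tt' next nofit.
have mono i : running t' done e i -> running t done e i.
  by case/andP=> si te; rewrite /running si (le_lt_trans tt').
have sub (P : pred 'I_n) : (\sum_(i < n | running t' done e i && P i) q i <=
    \sum_(i < n | running t done e i && P i) q i)%N.
  rewrite [X in (X <= _)%N]big_mkcond [X in (_ <= X)%N]big_mkcond /=.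
  by apply: leq_sum => i _; case: ifP => // /andP[/mono -> ->].
split.
- exact: le_trans (greedy_t inv) tt'.
- move=> j j_n sj; have [rb bt ee ed] := greedy_started inv j_n sj.
  by split => //; apply: le_trans bt tt'.
- apply: leq_trans (greedy_busy inv).
  rewrite /busy [X in (X <= _)%N]big_mkcond [X in (_ <= X)%N]big_mkcond /=.
  by apply: leq_sum => i _; case: ifP => // /mono ->.
- move=> j j_n nj; apply: leq_trans (greedy_fit inv j_n nj).
  by rewrite leq_add2r sub.
- move=> j j_n nj.
  have bj := min_busy_le inv j_n nj (nofit _ j_n nj).
  have -> : (t' - r) * (min_busy j)%:R =
    (t - r) * (min_busy j)%:R + (t' - t) * (min_busy j)%:R by ring.
  apply: (@le_trans _ _ (work_done t done b + (t' - t) * (busy t done e)%:R)).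
    apply: lerD; first exact: greedy_work inv _ _ _.
    by rewrite ler_wpM2l ?subr_ge0 // ler_nat.
  rewrite /busy natr_sum mulr_sumr /work_done big_mkcondr /= -big_split /=.
  apply: ler_sum => i si; have [_ _ ei _] := greedy_started inv (ltn_ord i) si.
  case: ifPn => te.
    have := next i (ltn_ord i); rewrite /running si te => /(_ isT) t'e.
    rewrite (mulrC (t' - t)) -mulrDr ler_wpM2l //.
    have : Num.min (p i) (t - b i) <= t - b i by rewrite ge_min lexx orbT.
    by rewrite le_min => ?; apply/andP; split; lra.
  rewrite addr0 ler_wpM2l // le_min ge_min lexx /= ge_min.
  by apply/orP; right; lra.
Qed.

Hypothesis m0 : (0 < m)%N.

(* Graham's bound, with [D] the bound on the longest job and on the average load. *)
Lemma finish_bound (D x P : R) (k : nat) : (0 < k <= m)%N -> 0 < D -> 0 <= x ->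
  0 < P -> P <= D -> x * (maxn k (m.+1 - k))%:R + k%:R * P <= m%:R * D ->
  x + P <= (2 - m%:R^-1) * D.
Proof.
move=> /andP[k0 km] D0 x0 P0 PD H.
have mR : 0 < m%:R :> R by rewrite ltr0n.
have m1 : 1 <= m%:R :> R by rewrite ler1n.
have k1 : 1 <= k%:R :> R by rewrite ler1n.
have kmR : k%:R <= m%:R :> R by rewrite ler_nat.
rewrite -(ler_pM2l mR) mulrA (_ : m%:R * (2 - m%:R^-1) = 2 * m%:R - 1); last first.
  by field; rewrite gt_eqF.
have H1 : x * k%:R + k%:R * P <= m%:R * D.
  by apply: le_trans H; rewrite lerD2r ler_wpM2l // ler_nat leq_maxl.
have H2 : x * (m%:R + 1 - k%:R) + k%:R * P <= m%:R * D.
  apply: le_trans H; rewrite lerD2r ler_wpM2l //.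
  by rewrite natr1 -natrB ?ler_nat ?leq_maxr // ltnW.
(* If 2 k >= m + 1, the bound x + P <= m D / k is enough, since m^2 <= (2 m - 1) k. *)
have [big|small] := leP (m%:R + 1) (2 * k%:R : R).
  have mm : m%:R * m%:R <= (2 * m%:R - 1) * k%:R :> R by nra.
  have H3 : k%:R * (m%:R * (x + P)) <= k%:R * ((2 * m%:R - 1) * D) by nra.
  by rewrite ler_pM2l // in H3; lra.
set c : R := m%:R + 1 - k%:R in H2 *.
have c1 : 1 <= c by rewrite /c; lra.
have cm : c <= m%:R by rewrite /c; lra.
(* By P <= D and m = c + k - 1, [H2] gives x + P <= (2 - 1/c) D. This grows with c, and c = m occurs
   for k = 1. *)
have H3 : c * (x + P) <= (2 * c - 1) * D.
  have : (c - k%:R) * P <= (c - k%:R) * D by rewrite ler_wpM2l // /c; lra.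
  have : m%:R = c + k%:R - 1 by rewrite /c; ring.
  move=> em; rewrite em in H2; nra.
have H4 : c * (m%:R * (x + P)) <= c * ((2 * m%:R - 1) * D).
  have : m%:R * (c * (x + P)) <= m%:R * ((2 * c - 1) * D) by rewrite ler_pM2l.
  have : 0 <= (m%:R - c) * D by rewrite mulr_ge0 // ?subr_ge0 // ltW.
  by lra.
by rewrite ler_pM2l // in H4; lra.
Qed.

Lemma started_upd (done : nat -> nat) (j i : nat) :
  started (upd done j 1%N) i = (i == j) || started done i.
Proof. by rewrite /started /upd; case: (i == j). Qed.

Lemma work_done_le (t d : R) (done : nat -> nat) (b e : nat -> R) (j : nat) :
  greedy_inv t d done b e -> (j < n)%N -> ~~ started done j ->
  work_done t done b + (q j)%:R * p j <= \sum_(i < n) (q i)%:R * p i.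
Proof.
move=> inv j_n nj; rewrite [leRHS](bigD1 (Ordinal j_n)) //= [leRHS]addrC lerD2r.
rewrite /work_done big_mkcond [leRHS]big_mkcond /=; apply: ler_sum => i _.
have pi0 := p0 (ltn_ord i).
case: ifP => [si|_]; last by case: ifP => // _; rewrite mulr_ge0 // ltW.
rewrite ifT ?ler_wpM2l // ?ge_min ?lexx //.
by apply: contraNneq nj => ij; move: si; rewrite ij.
Qed.

Lemma greedy_start (t D : R) (done : nat -> nat) (b e : nat -> R) (j : nat) :
  let d := r + (2 - m%:R^-1) * D in
  (forall i, (i < n)%N -> p i <= D) -> \sum_(i < n) (q i)%:R * p i <= m%:R * D ->
  greedy_inv t d done b e -> (j < n)%N -> ~~ started done j ->
  (q j <= m - busy t done e)%N ->
  (forall i, (i < n)%N -> ~~ started done i -> (q i <= m - busy t done e)%N ->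
     (q i <= q j)%N) ->
  greedy_inv t d (upd done j 1%N) (upd b j t) (upd e j (t + p j)).
Proof.
move=> d pD area inv j_n nj fit largest.
have qj := q0 j_n; have pj := p0 j_n; have bm := greedy_busy inv.
have rt := greedy_t inv.
have run i : i != j -> running t (upd done j 1%N) (upd e j (t + p j)) i = running t done e i.
  by move=> ij; rewrite /running started_upd (negbTE ij) /= updN.
have runj : running t (upd done j 1%N) (upd e j (t + p j)) j.
  by rewrite /running started_upd eqxx /= updE ltrDl.
have busy' : busy t (upd done j 1%N) (upd e j (t + p j)) = (q j + busy t done e)%N.
  rewrite /busy (big_ord_update _ (P := running t done e) (F := q) j_n) ?runj //.
    by rewrite /running (negbTE nj).
  by move=> i _ ij; rewrite run.
split => //.
- move=> i i_n; rewrite started_upd; have [-> _|ij /= si] := eqVneq i j.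
    rewrite !updE; split => //.
    (* The area processed during the wait x = t - r and the area of [j] itself are together at most
       the total, which is the premise of [finish_bound]. *)
    have := greedy_work inv j_n nj; have := work_done_le inv j_n nj.
    have D0 : 0 < D by apply: lt_le_trans pj (pD j j_n).
    have := @finish_bound D (t - r) (p j) (q j) qj D0.
    rewrite subr_ge0 /min_busy /d => /(_ rt pj (pD j j_n)) fb h1 h2.
    suff : t - r + p j <= (2 - m%:R^-1) * D by lra.
    by apply: fb; lra.
  by rewrite !updN //; exact: greedy_started inv _ _ _.
- by rewrite busy'; lia.
- move=> i i_n; rewrite started_upd negb_or => /andP[ij ni].
  have fi := greedy_fit inv i_n ni.
  have -> : (\sum_(k < n | running t (upd done j 1%N) (upd e j (t + p j)%R) k && (q k < q i)) q k
      = (if q j < q i then q j else 0) +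
        \sum_(k < n | running t done e k && (q k < q i)) q k)%N.
    rewrite (big_ord_update _ (P' := fun k => running t (upd done j 1%N)
      (upd e j (t + p j)) k && (q k < q i)%N)
      (P := fun k => running t done e k && (q k < q i)%N) (F := q) j_n).
    - by rewrite runj.
    - by rewrite /running (negbTE nj).
    - by move=> k _ kj; rewrite run.
  case: ifP => // qji.
  have nfit : (m - busy t done e < q i)%N.
    by rewrite ltnNge; apply/negP => /(largest i i_n ni); rewrite leqNgt qji.
  have := min_busy_le inv i_n ni nfit.
  have : (\sum_(k < n | running t done e k && (q k < q i)%N) q k +
    \sum_(k < n | running t done e k && ~~ (q k < q i)%N) q k)%N = busy t done e.
    by rewrite /busy [RHS](bigID (fun k : 'I_n => (q k < q i)%N)).
  (* Job [i] is larger than [j] and does not fit. If some running job is at least as large as [i],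
     the room it takes would hold [i] beside the smaller ones and [j]. If all running jobs are
     smaller, [fi] says that [i] fits, a contradiction. *)
  case: (pselect (exists k : 'I_n, running t done e k && ~~ (q k < q i)%N)) => [[k rk]|nex].
    rewrite (bigD1 k rk) /=; move: rk => /andP[_]; rewrite -leqNgt.
    by move=> qik e1 _; lia.
  rewrite [X in (_ + X)%N]big_pred0 ?addn0.
    by move=> e1 _; lia.
  by move=> k; apply/negP => rk; apply: nex; exists k.
- move=> i i_n; rewrite started_upd negb_or => /andP[ij ni].
  apply: le_trans (greedy_work inv i_n ni) _; rewrite /work_done.
  rewrite [leRHS](big_ord_update _ (P' := started (upd done j 1%N)) (P := started done)
    (F' := fun k => (q k)%:R * Num.min (p k) (t - upd b j t k))
    (F := fun k => (q k)%:R * Num.min (p k) (t - b k)) j_n) //; last first.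
    by move=> k _ kj; rewrite started_upd (negbTE kj) updN.
  rewrite started_upd eqxx /= updE subrr lerDr mulr_ge0 //.
  by rewrite le_min ltW /=.
Qed.

Lemma greedy_init (d : R) (b e : nat -> R) : greedy_inv r d (fun=> 0%N) b e.
Proof.
split=> //; rewrite ?/busy ?big_pred0 //.
- by move=> j j_n _; rewrite big_pred0 //; case/andP: (q0 j_n).
- by move=> j j_n _; rewrite subrr mul0r /work_done big_pred0.
Qed.

End Greedy.

(** * A measure bounding the number of events *)

(** The number of events still ahead: start and end of an unstarted job, end of a running one. Jobs
    ending simultaneously only make it drop faster. *)
Definition potential (R : realType) (n : nat) (t : R) (done : nat -> nat) (e : nat -> R) : nat :=
  \sum_(i < n) (if started done i then nat_of_bool (t < e i)%R else 2).

Lemma potential_start (R : realType) (n : nat) (t : R) (done : nat -> nat)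
    (e : nat -> R) (j : nat) (x : R) :
  (j < n)%N -> ~~ started done j ->
  (potential n t (upd done j 1%N) (upd e j x) < potential n t done e)%N.
Proof.
move=> j_n nj; rewrite /potential !(bigD1 (Ordinal j_n) isT) /=.
rewrite started_upd eqxx (negbTE nj) /= updE.
rewrite (eq_bigr (fun i : 'I_n => if started done i then nat_of_bool (t < e i)%R else 2%N)).
  by case: (t < x); lia.
move=> i ij.
have inj : val i != j by apply: contraNneq ij => ij; apply/eqP/val_inj.
by rewrite started_upd (negbTE inj) updN.
Qed.

Lemma potential_advance (R : realType) (n : nat) (t t' : R) (done : nat -> nat)
    (e : nat -> R) (j : nat) :
  (j < n)%N -> running t done e j -> t' = e j ->
  (potential n t' done e < potential n t done e)%N.
Proof.
move=> j_n /andP[sj te] t'e; rewrite /potential !(bigD1 (Ordinal j_n) isT) /=.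
rewrite sj t'e ltxx te -addSn leq_add //; apply: leq_sum => i _.
by case: ifP => // _; have [lt1|] := ltP (e j) (e i); rewrite // (lt_trans te).
Qed.

Lemma potential_eq0 (R : realType) (n : nat) (t : R) (done : nat -> nat) (e : nat -> R) :
  potential n t done e = 0%N -> forall j, (j < n)%N -> started done j.
Proof.
move/eqP; rewrite sum_nat_eq0 => /forallP pot j j_n.
by have := pot (Ordinal j_n); rewrite /=; case: ifP.
Qed.

(** * Allotment of processors *)

Section Allocation.
Variables (R : realType) (m : nat).

Definition in_block (a l x : nat) : bool := (a <= x < a + l)%N.

(* Segment [i < K] is the block [a i, a i + l i) of processors, all of which are
   reserved until time [f i]; record [k < C] gives the block [rs k, rs k + rl k)
   to job [rj k], which runs during [b (rj k), e (rj k)). *)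
Record alloc_inv (t : R) (b e : nat -> R) (K : nat) (a l : nat -> nat) (f : nat -> R)
    (C : nat) (rj rs rl : nat -> nat) : Prop := AllocInv {
  alloc_total : (\sum_(i < K) l i = m)%N;
  alloc_seg_le : forall i, (i < K)%N -> (a i + l i <= m)%N;
  alloc_seg_inj : forall i i' x, (i < K)%N -> (i' < K)%N ->
    in_block (a i) (l i) x -> in_block (a i') (l i') x -> i = i';
  alloc_rec_le : forall k, (k < C)%N -> (rs k + rl k <= m)%N;
  alloc_ready : forall k i x, (k < C)%N -> (i < K)%N ->
    in_block (rs k) (rl k) x -> in_block (a i) (l i) x -> e (rj k) <= f i;
  alloc_disj : forall k k' x, (k < C)%N -> (k' < C)%N -> k != k' ->
    in_block (rs k) (rl k) x -> in_block (rs k') (rl k') x ->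
    e (rj k) <= b (rj k') \/ e (rj k') <= b (rj k);
  alloc_busy : forall t', t <= t' ->
    (\sum_(i < K | (t' < f i)%R) l i = \sum_(k < C | (t' < e (rj k))%R) rl k)%N }.

Lemma alloc_init (t : R) (b e : nat -> R) (a l : nat -> nat) (f : nat -> R)
    (rj rs rl : nat -> nat) : a 0%N = 0%N -> l 0%N = m -> f 0%N <= t ->
  alloc_inv t b e 1 a l f 0 rj rs rl.
Proof.
move=> a0 l0 f0; split => //.
- by rewrite big_ord1.
- by case=> // _; rewrite a0 l0.
- by case=> // -[].
- move=> t' tt'; rewrite big_ord0 big_pred0 // => i.
  by rewrite ord1 /= ltNge (le_trans f0).
Qed.

(** Immediate because [alloc_busy] covers all later times, so reservations expiring between [t] and
    [t'] need no case analysis. *)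
Lemma alloc_advance (t t' : R) (b e : nat -> R) (K : nat) (a l : nat -> nat)
    (f : nat -> R) (C : nat) (rj rs rl : nat -> nat) : t <= t' ->
  alloc_inv t b e K a l f C rj rs rl -> alloc_inv t' b e K a l f C rj rs rl.
Proof.
move=> tt' [h1 h2 h3 h4 h5 h6 h7]; split => // t2 t't2.
by apply: h7; apply: le_trans t't2.
Qed.

(** Lets the times of a job about to start be entered while no record belongs to it yet. *)
Lemma alloc_eq_times (t : R) (b b' e e' : nat -> R) (K : nat) (a l : nat -> nat)
    (f : nat -> R) (C : nat) (rj rs rl : nat -> nat) :
  (forall k, (k < C)%N -> b' (rj k) = b (rj k) /\ e' (rj k) = e (rj k)) ->
  alloc_inv t b e K a l f C rj rs rl -> alloc_inv t b' e' K a l f C rj rs rl.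
Proof.
move=> eqbe [h1 h2 h3 h4 h5 h6 h7]; split => //.
- by move=> k i x kC iK; rewrite (eqbe k kC).2; exact: h5.
- move=> k k' x kC k'C; have [-> ->] := eqbe k kC; have [-> ->] := eqbe k' k'C.
  exact: h6.
- by move=> t' tt'; rewrite h7 //; apply: eq_bigl => k; rewrite (eqbe k (ltn_ord k)).2.
Qed.

(** The predicate makes it serve both the total length and the length still reserved. *)
Lemma sum_split (P : pred nat) (K i x : nat) (l : nat -> nat) : (i < K)%N -> (x <= l i)%N ->
  forall P', (forall y, (y < K)%N -> P' y = P y) -> P' K = P i ->
  (\sum_(y < K.+1 | P' y) upd (upd l i x) K (l i - x) y = \sum_(y < K | P y) l y)%N.
Proof.
move=> iK xl P' PP' PK.
rewrite big_mkcond [in RHS]big_mkcond big_ord_recr /= PK updE (bigD1 (Ordinal iK)) //=.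
rewrite [in RHS](bigD1 (Ordinal iK)) //= PP' // [upd _ K _ i]updN ?updE; last by rewrite neq_ltn iK.
rewrite (eq_bigr (fun y : 'I_K => if P y then l y else 0%N)); last first.
  move=> y yi; have y_i : val y != i by apply: contraNneq yi => yi; apply/eqP/val_inj.
  by rewrite PP' // !updN // neq_ltn ltn_ord.
by case: ifP => // _; lia.
Qed.

Lemma alloc_split (t : R) (b e : nat -> R) (K : nat) (a l : nat -> nat) (f : nat -> R)
    (C : nat) (rj rs rl : nat -> nat) (i x : nat) : (i < K)%N -> (x <= l i)%N ->
  alloc_inv t b e K a l f C rj rs rl ->
  alloc_inv t b e K.+1 (upd a K (a i + x)%N) (upd (upd l i x) K (l i - x)%N)
    (upd f K (f i)) C rj rs rl.
Proof.
move=> iK xl [h1 h2 h3 h4 h5 h6 h7].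
(* Every segment lies inside its [origin], the segment it was cut from, so properties of points are
   inherited. Only the two pieces of [i] share an origin, and the cut at [x] separates them. *)
pose origin y := if y == K then i else y.
have originK y : (y < K.+1)%N -> (origin y < K)%N.
  by rewrite /origin; case: eqP => // yK; lia.
have sub y z : in_block (upd a K (a i + x)%N y) (upd (upd l i x) K (l i - x)%N y) z ->
    in_block (a (origin y)) (l (origin y)) z.
  rewrite /origin /upd /in_block; case: eqP => [_|_]; first by lia.
  by case: eqP => // ->; lia.
split => //.
- by rewrite (@sum_split predT K i x l iK xl predT).
- move=> y yK; rewrite /upd; case: eqP => [_|yK']; first by have := h2 i iK; lia.
  by have := h2 y; case: eqP => [->|_]; lia.
- move=> y y' z yK y'K h h';
  have := h3 _ _ z (originK _ yK) (originK _ y'K) (sub _ _ h) (sub _ _ h').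
  move: h h'; rewrite /origin /upd /in_block.
  have [eyK|nyK] := eqVneq y K; have [ey'K|ny'K] := eqVneq y' K => h h' eyy'.
  - by rewrite eyK.
  - by move: h'; rewrite -eyy' eqxx; lia.
  - by move: h; rewrite eyy' eqxx; lia.
  - by [].
- move=> k y z kC yK hk hy; have := h5 k (origin y) z kC (originK y yK) hk (sub _ _ hy).
  by rewrite /origin /upd; case: eqP.
- move=> t' tt'; rewrite -h7 //.
  apply: (@sum_split (fun y => t' < f y) K i x l iK xl (fun y => t' < upd f K (f i) y)).
    by move=> y yK; rewrite updN // neq_ltn yK.
  by rewrite updE.
Qed.

Lemma sum_rcons (P P' : pred nat) (C : nat) (F : nat -> nat) (v : nat) :
  (forall k, (k < C)%N -> P' k = P k) ->
  (\sum_(k < C.+1 | P' k) upd F C v k = \sum_(k < C | P k) F k + (if P' C then v else 0))%N.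
Proof.
move=> PP'; rewrite big_mkcond big_ord_recr /= updE; congr (_ + _)%N.
rewrite [RHS]big_mkcond; apply: eq_bigr => k _.
by rewrite PP' // updN // neq_ltn ltn_ord.
Qed.

Lemma alloc_take (t : R) (b e : nat -> R) (K : nat) (a l : nat -> nat) (f : nat -> R)
    (C : nat) (rj rs rl : nat -> nat) (i j : nat) : (i < K)%N -> f i <= t ->
  b j = t -> t < e j ->
  alloc_inv t b e K a l f C rj rs rl ->
  alloc_inv t b e K a l (upd f i (e j)) C.+1 (upd rj C j) (upd rs C (a i)) (upd rl C (l i)).
Proof.
move=> iK fit bj ej [h1 h2 h3 h4 h5 h6 h7].
have fle y : f y <= upd f i (e j) y.
  by rewrite /upd; case: eqP => [->|//]; rewrite (le_trans fit) // ltW.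
split => //.
- move=> k; rewrite /upd ltnS leq_eqVlt; case: eqP => [_ _|_ /= kC]; first exact: h2.
  exact: h4.
- move=> k y z; rewrite ltnS leq_eqVlt /upd; case: eqP => [_ _|_ /= kC] yK hk hy.
    by rewrite (h3 _ _ z yK iK hy hk) eqxx.
  exact: le_trans (h5 k y z kC yK hk hy) (fle y).
(* Segment [i] is free at [t], so an earlier record meeting it ended by [t], the start of [j]. *)
- have old k z : (k < C)%N -> in_block (rs k) (rl k) z -> in_block (a i) (l i) z ->
      e (rj k) <= b j.
    by move=> kC hk hi; rewrite bj (le_trans _ fit) // (h5 k i z).
  move=> k k' z; rewrite !ltnS (leq_eqVlt k) (leq_eqVlt k') /upd.
  case: eqP => [->|_] /=; case: eqP => [->|_] //=; rewrite ?eqxx //.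
  + by move=> _ k'C _ hk hk'; right; exact: old hk' hk.
  + by move=> kC _ _ hk hk'; left; exact: old hk hk'.
  + exact: h6.
- move=> t' tt'.
  rewrite (sum_rcons (P := fun k => t' < e (rj k))
    (P' := fun k => t' < e (upd rj C j k))); last first.
    by move=> k kC; rewrite updN // neq_ltn kC.
  rewrite updE -h7 // addnC.
  have -> : (\sum_(y < K | (t' < upd f i (e j) y)%R) l y =
      (if (t' < e j)%R then l i else 0) + \sum_(y < K | (t' < f y)%R) l y)%N.
    rewrite (big_ord_update _ (P' := fun y => t' < upd f i (e j) y)
      (P := fun y => t' < f y) (F := l) iK) ?updE //.
      by rewrite -leNgt (le_trans fit).
    by move=> y _ yi; rewrite updN.
  by [].
Qed.

End Allocation.

(** Connects the greedy count with the segments: the [m - busy] idle processors are exactly those in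
    segments whose reservation has expired, so a job that fits by count finds its processors. *)
Lemma busy_alloc (R : realType) (n m : nat) (q : nat -> nat) (t : R) (done : nat -> nat)
    (b e : nat -> R) (K : nat) (a l : nat -> nat) (f : nat -> R) (C : nat)
    (rj rs rl : nat -> nat) :
  alloc_inv m t b e K a l f C rj rs rl ->
  (forall k, (k < C)%N -> (rj k < n)%N /\ started done (rj k)) ->
  (forall j, (j < n)%N -> started done j -> (\sum_(k < C | rj k == j) rl k)%N = q j) ->
  busy n q t done e = (\sum_(i < K | (t < f i)%R) l i)%N.
Proof.
move=> inv recs sizes; rewrite (alloc_busy inv) //.
transitivity (\sum_(j < n | running t done e j) \sum_(k < C | rj k == j) rl k)%N.
  by apply: eq_bigr => j /andP[sj _]; rewrite sizes.
rewrite (exchange_big_dep predT) //= [RHS]big_mkcond; apply: eq_bigr => k _.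
have [kn sk] := recs k (ltn_ord k).
have [te|te] := ltP t (e (rj k)).
  rewrite (big_pred1 (Ordinal kn)) // => j /=.
  rewrite -val_eqE /= eq_sym; apply: andb_idl => /eqP ->.
  by rewrite /running sk te.
rewrite big_pred0 // => j; apply/negP => /andP[/andP[_ tj] /eqP kj].
by move: tj; rewrite -kj ltNge te.
Qed.

Lemma card_block (m a l : nat) : (a + l <= m)%N -> #|[set p : 'I_m | in_block a l p]| = l.
Proof.
move=> alm; rewrite -sum1_card (eq_bigl (fun p : 'I_m => in_block a l p)); last first.
  by move=> p; rewrite inE.
rewrite -(big_mkord (in_block a l) (fun=> 1%N)).
rewrite -[RHS]muln1 -[in RHS](addKn a l) -sum_nat_const_nat.
rewrite (big_nat_widen _ _ _ _ _ alm) (big_nat_widenl _ _ _ _ _ (leq0n a)).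
by apply: eq_bigl => p; rewrite andbC.
Qed.

Definition alloc_procs (m C : nat) (rj rs rl : nat -> nat) (j : nat) : {set 'I_m} :=
  [set p : 'I_m | [exists k : 'I_C, (rj k == j) && in_block (rs k) (rl k) p]].

(** Two overlapping records of the same job would force [e j <= b j]; hence its blocks are disjoint
    and their lengths add up. *)
Lemma card_alloc_procs (R : realType) (m : nat) (t : R) (b e : nat -> R) (K : nat)
    (a l : nat -> nat) (f : nat -> R) (C : nat) (rj rs rl : nat -> nat) (j : nat) :
  alloc_inv m t b e K a l f C rj rs rl -> b j < e j ->
  #|alloc_procs m C rj rs rl j| = (\sum_(k < C | rj k == j) rl k)%N.
Proof.
move=> inv be.
transitivity (\sum_(k < C | rj k == j) \sum_(p < m | in_block (rs k) (rl k) p) 1)%N; last first.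
  apply: eq_bigr => k _; rewrite sum1_card -[RHS](card_block (alloc_rec_le inv (ltn_ord k))).
  by apply: eq_card => p; rewrite inE.
rewrite (exchange_big_dep predT) //= -sum1_card big_mkcond; apply: eq_bigr => p _.
rewrite inE; case: existsP => [[k /andP[kj kp]]|nex].
  rewrite (big_pred1 k) // => k'; apply/andP/eqP => [[/eqP k'j k'p]|->] //.
  apply/eqP/negPn/negP => kk'.
  have kk : val k' != val k by rewrite val_eqE.
  have := alloc_disj inv (ltn_ord k') (ltn_ord k) kk k'p kp.
  by rewrite k'j (eqP kj) => -[]; rewrite leNgt be.
by rewrite big_pred0 // => k; apply/negP => kp; apply: nex; exists k.
Qed.

Lemma disjoint_alloc_procs (R : realType) (m : nat) (t : R) (b e : nat -> R) (K : nat)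
    (a l : nat -> nat) (f : nat -> R) (C : nat) (rj rs rl : nat -> nat) (i j : nat) (x : R) :
  alloc_inv m t b e K a l f C rj rs rl -> i != j ->
  b i <= x < e i -> b j <= x < e j ->
  [disjoint alloc_procs m C rj rs rl i & alloc_procs m C rj rs rl j].
Proof.
move=> inv ij /andP[bi ei] /andP[bj ej]; apply/pred0P => p /=.
apply/negP; rewrite !inE => /andP[/existsP[k /andP[/eqP ki kp]] /existsP[k' /andP[/eqP k'j k'p]]].
have kk' : val k != val k' by apply: contraNneq ij => kk'; rewrite -ki -k'j kk'.
have := alloc_disj inv (ltn_ord k) (ltn_ord k') kk' kp k'p.
rewrite ki k'j => -[h|h].
  by have := lt_le_trans ei (le_trans h bj); rewrite ltxx.
by have := lt_le_trans ej (le_trans h bi); rewrite ltxx.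
Qed.

(** * The program *)

Ltac is_literal k := match k with O => idtac | S ?j => is_literal j end.

(* Evaluates lookups at literal addresses only: updates of arrays at symbolic indices
   must stay folded to match the lemmas on allotments. *)
Ltac mem_simpl :=
  cbn [den neval reval beval set_nvar set_narr set_rvar set_rarr nvar narr rvar rarr];
  repeat match goal with
  | |- context [@upd ?T ?f ?x ?v ?y] =>
      is_literal x; is_literal y;
      let b := eval compute in (y == x) in
      match b with
      | true => change (@upd T f x v y) with v
      | false => change (@upd T f x v y) with (f y)
      end
  end.

(* Memory besides that of [input] and [output].  Natural variables: 4, 5 and 13 loop
   indices, 6 number of segments, 7 idle processors, 8 and 9 the job to start and its
   size, 10 processors it still lacks, 11 and 12 loop bounds, 14 scratch.  Natural
   arrays: 5 and 6 start and length of the segments, 7 started jobs, 8 saturated jobs.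
   Real variables: 0 release time, 1 window length, 2 scratch sum, 3 [free_work],
   4 [free_procs], 5 [opt_speed], 6 current time, 7 next completion.  Real arrays:
   6 time until which a segment is reserved, 7 durations.  Execution record [j] is the
   one of job [j], so real arrays 3, 4 and 5 are indexed by jobs. *)
Definition sum_body : com :=
  If (RLe (RGet 0 (NVar 5)) (RGet 0 (NVar 4)))
    (RSet 2 (RAdd (RVar 2) (RMul (ROfNat (NGet 0 (NVar 5))) (RGet 0 (NVar 5)))))
    (RSet 2 (RAdd (RVar 2) (RMul (ROfNat (NGet 0 (NVar 5))) (RGet 0 (NVar 4))))).

Definition sat_body : com :=
  Seq (RSet 2 (ROfNat (NConst 0)))
  (Seq (For 5 0 sum_body)
  (If (RLe (RVar 2) (RMul (ROfNat (NVar 1)) (RGet 0 (NVar 4))))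
    (Seq (NPut 8 (NVar 4) (NConst 1))
         (RSet 4 (RSub (RVar 4) (ROfNat (NGet 0 (NVar 4))))))
    (Seq (NPut 8 (NVar 4) (NConst 0))
         (RSet 3 (RAdd (RVar 3) (RMul (ROfNat (NGet 0 (NVar 4))) (RGet 0 (NVar 4)))))))).

Definition scaled (e : rexp) : rexp :=
  RDiv (RMul e (ROfNat (NVar 1)))
       (RSub (RMul (ROfNat (NConst 2)) (ROfNat (NVar 1))) (ROfNat (NConst 1))).

Definition dur_body : com :=
  Seq (If (NEq (NGet 8 (NVar 4)) (NConst 1))
    (RPut 7 (NVar 4) (scaled (RVar 1)))
    (RPut 7 (NVar 4) (scaled (RDiv (RGet 0 (NVar 4)) (RVar 5)))))
  (Seq (RPut 5 (NVar 4) (RDiv (RGet 0 (NVar 4)) (RGet 7 (NVar 4))))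
       (NPut 1 (NVar 4) (NVar 4))).

Definition dur_prog : com :=
  Seq (Seq (RSet 0 (RGet 1 (NConst 0)))
      (Seq (RSet 1 (RSub (RGet 2 (NConst 0)) (RVar 0)))
      (Seq (RSet 3 (ROfNat (NConst 0)))
           (RSet 4 (ROfNat (NVar 1))))))
  (Seq (For 4 0 sat_body)
  (Seq (RSet 5 (RDiv (RVar 3) (RMul (RVar 4) (RVar 1))))
       (For 4 0 dur_body))).

(** * Correctness of the computation of durations *)

Lemma sum_loop (R : realType) (s : state R) :
  spec (For 5 0 sum_body) s (nvar s 0 * (ccost sum_body + 10) + 8) (fun s' =>
    rvar s' 2 = rvar s 2 + \sum_(i < nvar s 0)
      (narr s 0 i)%:R * Num.min (rarr s 0 i) (rarr s 0 (nvar s 4))).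
Proof.
apply: (spec_for (Inv := fun k s1 => rvar s1 2 = rvar s 2 + \sum_(i < k)
    (narr s 0 i)%:R * Num.min (rarr s 0 i) (rarr s 0 (nvar s 4)))) => //.
- by rewrite big_ord0 addr0.
- move=> k s1 kn s1k [fnv fna _ fra] inv1; apply: spec_loopfree => //.
  rewrite /sum_body; mem_simpl;
  rewrite s1k (fnv 4%N isT) (fra 0%N isT) (fna 0%N isT) big_ord_recr /= addrA.
  by case: ifP => [le|/negbT]; mem_simpl; rewrite inv1 ?s1k ?(fnv 4%N isT) ?(fra 0%N isT)
    ?(fna 0%N isT) ?(min_idPl le) // -ltNge => /ltW le; rewrite (min_idPr le).
Qed.

Lemma sat_loop (R : realType) (s : state R) : let n := nvar s 0 in
  let sat := saturated n (nvar s 1) (narr s 0) (rarr s 0) in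
  rvar s 3 = 0 -> rvar s 4 = (nvar s 1)%:R ->
  spec (For 4 0 sat_body) s (n * (n * (ccost sum_body + 10) + 8 + 100 + 10) + 8) (fun s' =>
    [/\ rvar s' 3 = free_work n (nvar s 1) (narr s 0) (rarr s 0),
        rvar s' 4 = free_procs n (nvar s 1) (narr s 0) (rarr s 0) &
        forall j, (j < n)%N -> (narr s' 8 j == 1%N) = sat j]).
Proof.
move=> n sat s3 s4.
apply: (spec_for (Inv := fun k s1 =>
  [/\ rvar s1 3 = \sum_(i < k | ~~ sat i) (narr s 0 i)%:R * rarr s 0 i,
      rvar s1 4 = (nvar s 1)%:R - \sum_(i < k | sat i) (narr s 0 i)%:R &
      forall j, (j < k)%N -> (narr s1 8 j == 1%N) = sat j])) => //.
- by split; rewrite ?big_ord0 ?subr0.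
- move=> k s1 kn s1k [fnv fna frv fra] [inv3 inv4 inv8].
  (* The reset of the scratch sum costs 3, leaving 97 as a generous bound for the conditional after
     the inner loop. *)
  have -> : (n * (ccost sum_body + 10) + 8 + 100 =
    ccost (RSet 2 (ROfNat (NConst 0))) + (n * (ccost sum_body + 10) + 8 + 97))%N.
    by rewrite /=; lia.
  apply/spec_seq/spec_loopfree => //; apply: spec_seq.
  rewrite (_ : n = nvar (den (RSet 2 (ROfNat (NConst 0))) s1) 0); last first.
    by mem_simpl; rewrite (fnv 0%N isT).
  apply/spec_frame/(spec_weaken (sum_loop _)) => //.
  mem_simpl; move=> s2 s22 [gnv gna grv gra].
  have e4 : nvar s2 4 = k by rewrite (gnv 4%N isT).
  have e1 : nvar s2 1 = nvar s 1 by rewrite (gnv 1%N isT) (fnv 1%N isT).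
  have a0 : narr s2 0 = narr s 0 by rewrite (gna 0%N isT) (fna 0%N isT).
  have b0 : rarr s2 0 = rarr s 0 by rewrite (gra 0%N isT) (fra 0%N isT).
  have v3 : rvar s2 3 = rvar s1 3 by rewrite (grv 3%N isT).
  have v4 : rvar s2 4 = rvar s1 4 by rewrite (grv 4%N isT).
  have a8 : narr s2 8 = narr s1 8 by rewrite (gna 8%N isT).
  have s22' : (rvar s2 2 <= (nvar s2 1)%:R * rarr s2 0 (nvar s2 4)) = sat k.
    rewrite s22 add0r e1 e4 b0 s1k (fnv 0%N isT) (fna 0%N isT) (fra 0%N isT) //.
  apply: spec_le (spec_loopfree _ _) _ => //.
  mem_simpl; rewrite s22'; case: ifP => sk; mem_simpl; rewrite e4 a0 ?b0 ?v3 ?v4 a8 ?inv3 ?inv4.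
  + split.
    * by rewrite big_mkcond [RHS]big_mkcond big_ord_recr /= sk addr0.
    * by rewrite [in RHS]big_mkcond big_ord_recr /= sk -big_mkcond opprD addrA.
    * move=> j; rewrite ltnS leq_eqVlt; have [->|jk /= lt] := eqVneq j k.
        by rewrite updE sk.
      by rewrite updN // inv8.
  + split.
    * by rewrite [in RHS]big_mkcond big_ord_recr /= sk -big_mkcond.
    * by rewrite [in RHS]big_mkcond big_ord_recr /= sk -big_mkcond addr0.
    * move=> j; rewrite ltnS leq_eqVlt; have [->|jk /= lt] := eqVneq j k.
        by rewrite updE sk.
      by rewrite updN // inv8.
Qed.

Definition scaled_dur (R : realType) (n m : nat) (q : nat -> nat) (W : nat -> R) (D : R)
    (j : nat) : R :=
  opt_dur n m q W D j * m%:R / (2 * m%:R - 1).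

Lemma dur_loop (R : realType) (s : state R) :
  let n := nvar s 0 in let m := nvar s 1 in
  (forall j, (j < n)%N -> (narr s 8 j == 1%N) = saturated n m (narr s 0) (rarr s 0) j) ->
  rvar s 5 = opt_speed n m (narr s 0) (rarr s 0) (rvar s 1) ->
  spec (For 4 0 dur_body) s (n * (ccost dur_body + 10) + 8) (fun s' =>
    forall j, (j < n)%N ->
      [/\ rarr s' 7 j = scaled_dur n m (narr s 0) (rarr s 0) (rvar s 1) j,
          rarr s' 5 j = rarr s 0 j / rarr s' 7 j & narr s' 1 j = j]).
Proof.
move=> n m satE s5.
apply: (spec_for (Inv := fun k s1 => forall j, (j < k)%N ->
  [/\ rarr s1 7 j = scaled_dur n m (narr s 0) (rarr s 0) (rvar s 1) j,
      rarr s1 5 j = rarr s 0 j / rarr s1 7 j & narr s1 1 j = j])) => //.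
move=> k s1 kn s1k [fnv fna frv fra] inv; apply: spec_loopfree => //.
rewrite /dur_body /scaled; mem_simpl.
rewrite s1k (fna 8%N isT) satE // => j; rewrite ltnS leq_eqVlt.
move=> jk; have {jk} : (j == k) || (j != k) && (j < k)%N by case: eqVneq jk.
case/orP => [/eqP->|/andP[jk lt]]; case: ifP => satk; mem_simpl; rewrite ?s1k.
- rewrite !updE (fra 0%N isT) (fnv 1%N isT) (frv 1%N isT).
  by split=> //; rewrite /scaled_dur /opt_dur satk.
- rewrite !updE ?s1k (fra 0%N isT) (fnv 1%N isT) (frv 5%N isT) s5.
  by split=> //; rewrite /scaled_dur /opt_dur satk.
- by rewrite !updN //; exact: inv.
- by rewrite !updN //; exact: inv.
Qed.

Lemma dur_progP (R : realType) (s : state R) :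
  let n := nvar s 0 in let m := nvar s 1 in let D := rarr s 2 0%N - rarr s 1 0%N in
  spec dur_prog s (n * (n * (ccost sum_body + 10) + ccost dur_body + 150) + 60) (fun s' =>
    rvar s' 0 = rarr s 1 0%N /\
    forall j, (j < n)%N ->
      [/\ rarr s' 7 j = scaled_dur n m (narr s 0) (rarr s 0) D j,
          rarr s' 5 j = rarr s 0 j / rarr s' 7 j & narr s' 1 j = j]).
Proof.
move=> n m D.
rewrite /dur_prog; set c1 := Seq (RSet 0 _) _.
(* Destructing the existential makes the state opaque; the few cells that matter are read off once,
   and later terms stay small. The same device recurs below. *)
have [s1 s1E] : exists s1, s1 = den c1 s by exists (den c1 s).
have n1 : nvar s1 0 = n by rewrite s1E.
have m1 : nvar s1 1 = m by rewrite s1E.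
have q1 : narr s1 0 = narr s 0 by rewrite s1E.
have W1 : rarr s1 0 = rarr s 0 by rewrite s1E.
have r1 : rvar s1 0 = rarr s 1 0%N by rewrite s1E.
have D1 : rvar s1 1 = D by rewrite s1E.
apply: spec_le; first (apply/spec_seq/spec_loopfree => //; rewrite -/c1 -s1E).
  apply/spec_seq/spec_frame/(spec_weaken (sat_loop (s := s1) _ _)).
  - by rewrite s1E.
  - by rewrite s1E.
  - exact: leqnn.
  rewrite n1 m1 q1 W1 => s2 [s23 s24 s28] [fnv fna frv fra].
  apply/spec_seq/spec_loopfree => //.
  have [s3 s3E] : exists s3, s3 = den (RSet 5 (RDiv (RVar 3) (RMul (RVar 4) (RVar 1)))) s2.
    by exists (den (RSet 5 (RDiv (RVar 3) (RMul (RVar 4) (RVar 1)))) s2).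
  rewrite -s3E.
  have n3 : nvar s3 0 = n by rewrite s3E -n1 -(fnv 0%N isT).
  have m3 : nvar s3 1 = m by rewrite s3E -m1 -(fnv 1%N isT).
  have q3 : narr s3 0 = narr s 0 by rewrite s3E -q1 -(fna 0%N isT).
  have W3 : rarr s3 0 = rarr s 0 by rewrite s3E -W1 -(fra 0%N isT).
  have D3 : rvar s3 1 = D by rewrite s3E -D1 -(frv 1%N isT).
  have r3 : rvar s3 0 = rarr s 1 0%N by rewrite s3E -r1 -(frv 0%N isT).
  apply/spec_frame/(spec_weaken (dur_loop (s := s3) _ _)).
  - by rewrite n3 m3 q3 W3 s3E => j jn; rewrite -s28.
  - by rewrite n3 m3 q3 W3 D3 s3E /=; mem_simpl; rewrite s23 s24 (frv 1%N isT) D1.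
  - rewrite n3; exact: leqnn.
  by rewrite n3 m3 q3 W3 D3 => s4 s4P [_ _ grv _]; split; rewrite ?(grv 0%N isT).
by rewrite n1 /=; lia.
Qed.

(** * The scheduling program *)

(** Real variable 7 equal to the current time means that no completion has been found; this is
    unambiguous because running jobs end strictly later. *)
Definition scan_body : com :=
  If (BAnd (NEq (NGet 7 (NVar 4)) (NConst 1)) (BNot (RLe (RGet 4 (NVar 4)) (RVar 6))))
    (Seq (NSet 7 (NSub (NVar 7) (NGet 0 (NVar 4))))
      (If (BAnd (BNot (REq (RVar 7) (RVar 6))) (RLe (RVar 7) (RGet 4 (NVar 4))))
        Skip (RSet 7 (RGet 4 (NVar 4)))))
    Skip.

(** Size 0 in variable 9 means that no candidate has been found, as sizes are positive. *)
Definition best_body : com :=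
  If (BAnd (BNot (NEq (NGet 7 (NVar 4)) (NConst 1)))
       (BAnd (NLe (NGet 0 (NVar 4)) (NVar 7)) (BNot (NLe (NGet 0 (NVar 4)) (NVar 9)))))
    (Seq (NSet 8 (NVar 4)) (NSet 9 (NGet 0 (NVar 4))))
    Skip.

(** The writes follow the nesting of [upd] in [alloc_split], and [1 +] on the left computes to a
    successor, so [split_progP] holds by conversion. The scratch variable saves the remaining length
    before the old one is overwritten. *)
Definition split_prog : com :=
  Seq (NPut 5 (NVar 6) (NAdd (NGet 5 (NVar 5)) (NVar 10)))
  (Seq (NSet 14 (NSub (NGet 6 (NVar 5)) (NVar 10)))
  (Seq (NPut 6 (NVar 5) (NVar 10))
  (Seq (NPut 6 (NVar 6) (NVar 14))
  (Seq (RPut 6 (NVar 6) (RGet 6 (NVar 5)))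
       (NSet 6 (NAdd (NConst 1) (NVar 6))))))).

Definition take_prog : com :=
  Seq (NPut 2 (NVar 3) (NVar 8))
  (Seq (NPut 3 (NVar 3) (NGet 5 (NVar 5)))
  (Seq (NPut 4 (NVar 3) (NGet 6 (NVar 5)))
  (Seq (NSet 3 (NAdd (NConst 1) (NVar 3)))
  (Seq (RPut 6 (NVar 5) (RGet 4 (NVar 8)))
       (NSet 10 (NSub (NVar 10) (NGet 6 (NVar 5)))))))).

Definition alloc_body : com :=
  If (BAnd (RLe (RGet 6 (NVar 5)) (RVar 6)) (NLe (NConst 1) (NVar 10)))
    (Seq (If (NLe (NGet 6 (NVar 5)) (NVar 10)) Skip split_prog) take_prog)
    Skip.

(** Variable 11 freezes the number of segments, since the body may append one. The appended piece
    need not be visited: a cut occurs only when it completes the allotment. *)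
Definition start_prog : com :=
  Seq (Seq (NPut 7 (NVar 8) (NConst 1))
      (Seq (RPut 3 (NVar 8) (RVar 6))
      (Seq (RPut 4 (NVar 8) (RAdd (RVar 6) (RGet 7 (NVar 8))))
      (Seq (NSet 10 (NVar 9))
           (NSet 11 (NVar 6))))))
      (For 5 11 alloc_body).

Definition step_prog : com :=
  Seq (Seq (NSet 7 (NVar 1)) (RSet 7 (RVar 6)))
  (Seq (For 4 0 scan_body)
  (Seq (Seq (NSet 8 (NConst 0)) (NSet 9 (NConst 0)))
  (Seq (For 4 0 best_body)
       (If (NEq (NVar 9) (NConst 0)) (RSet 6 (RVar 7)) start_prog)))).

Definition schedule_prog : com :=
  Seq (Seq (RSet 6 (RVar 0))
      (Seq (NSet 6 (NConst 1))
      (Seq (NPut 5 (NConst 0) (NConst 0))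
      (Seq (NPut 6 (NConst 0) (NVar 1))
      (Seq (RPut 6 (NConst 0) (RVar 0))
      (Seq (NSet 3 (NConst 0))
      (Seq (NSet 2 (NVar 0))
           (NSet 12 (NAdd (NVar 0) (NVar 0))))))))))
      (For 13 12 step_prog).

(** * Correctness of the two scans over the jobs *)

Lemma scan_loop (R : realType) (s : state R) :
  let n := nvar s 0 in let t := rvar s 6 in
  let run := running t (narr s 7) (rarr s 4) in
  nvar s 7 = nvar s 1 -> rvar s 7 = t ->
  spec (For 4 0 scan_body) s (n * (ccost scan_body + 10) + 8) (fun s' =>
    nvar s' 7 = (nvar s 1 - busy n (narr s 0) t (narr s 7) (rarr s 4))%N /\
    ((forall i, (i < n)%N -> ~~ run i) /\ rvar s' 7 = t \/
     exists2 j, (j < n)%N /\ run j & rvar s' 7 = rarr s 4 j /\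
       forall i, (i < n)%N -> run i -> rarr s 4 j <= rarr s 4 i)).
Proof.
move=> n t run s7 r7.
apply: (spec_for (Inv := fun k s1 =>
    nvar s1 7 = (nvar s 1 - \sum_(i < k | run i) narr s 0 i)%N /\
    ((forall i, (i < k)%N -> ~~ run i) /\ rvar s1 7 = t \/
     exists2 j, (j < k)%N /\ run j & rvar s1 7 = rarr s 4 j /\
       forall i, (i < k)%N -> run i -> rarr s 4 j <= rarr s 4 i))) => //.
- by rewrite big_ord0 subn0; split => //; left.
- move=> k s1 kn s1k [fnv fna frv fra] [inv7 invn]; apply: spec_loopfree => //.
  rewrite /scan_body; mem_simpl.
  rewrite s1k (fna 7%N isT) (fra 4%N isT) (frv 6%N isT) -ltNge -/(started _ _).
  rewrite -/(running _ _ _ k) -/t -/run big_mkcond big_ord_recr /= -big_mkcond.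
  have lt_cases i : (i < k.+1)%N -> i = k \/ (i < k)%N.
    by rewrite ltnS leq_eqVlt => /orP[/eqP|]; [left|right].
  case: ifP => runk; last first.
    mem_simpl; rewrite addn0; split => //; case: invn => [[none ->]|[j [jk runj] [-> jmin]]].
      by left; split => // i /lt_cases[->|]; [rewrite runk|exact: none].
    right; exists j; first by split => //; exact: ltnW.
    by split => // i /lt_cases[->|ik]; [rewrite runk|exact: jmin].
  have te : t < rarr s 4 k by case/andP: runk.
  rewrite subnDA -inv7; mem_simpl; rewrite (fna 0%N isT).
  have new : (forall i, (i < k)%N -> run i -> rarr s 4 k <= rarr s 4 i) ->
      exists2 j, (j < k.+1)%N /\ run j & rarr s 4 k = rarr s 4 j /\
       forall i, (i < k.+1)%N -> run i -> rarr s 4 j <= rarr s 4 i.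
    move=> h; exists k => //; split => // i /lt_cases[-> //|]; exact: h.
  case: ifP => cmp; mem_simpl; rewrite ?s1k ?(fra 4%N isT); split => //; right.
    case: invn cmp => [[_ ->]|[j [jk runj] [-> jmin]] /andP[_ le]]; first by rewrite eqxx.
    exists j; first by split => //; exact: ltnW.
    by split => // i /lt_cases[->|ik]; last exact: jmin.
  apply: new => i ik runi; case: invn cmp => [[none _]|[j [jk runj] [-> jmin]]].
    by have := none i ik; rewrite runi.
  have : rarr s 4 j != t by rewrite gt_eqF //; case/andP: runj.
  by move=> -> /= /negbT; rewrite -ltNge => /ltW /le_trans; apply; exact: jmin.
Qed.

Lemma best_loop (R : realType) (s : state R) : let n := nvar s 0 in
  nvar s 9 = 0%N ->
  spec (For 4 0 best_body) s (n * (ccost best_body + 10) + 8) (fun s' =>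
    (forall i, (i < n)%N -> ~~ started (narr s 7) i -> (narr s 0 i <= nvar s 7)%N ->
       (narr s 0 i <= nvar s' 9)%N) /\
    (nvar s' 9 != 0%N -> [/\ (nvar s' 8 < n)%N, ~~ started (narr s 7) (nvar s' 8),
       narr s 0 (nvar s' 8) = nvar s' 9 & (nvar s' 9 <= nvar s 7)%N])).
Proof.
move=> n s9.
apply: (spec_for (Inv := fun k s1 =>
    (forall i, (i < k)%N -> ~~ started (narr s 7) i -> (narr s 0 i <= nvar s 7)%N ->
       (narr s 0 i <= nvar s1 9)%N) /\
    (nvar s1 9 != 0%N -> [/\ (nvar s1 8 < k)%N, ~~ started (narr s 7) (nvar s1 8),
       narr s 0 (nvar s1 8) = nvar s1 9 & (nvar s1 9 <= nvar s 7)%N]))) => //.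
- by split=> //; mem_simpl; rewrite s9.
- move=> k s1 kn s1k [fnv fna frv fra] [invl inv]; apply: spec_loopfree => //.
  rewrite /best_body; mem_simpl.
  rewrite s1k (fna 7%N isT) (fna 0%N isT) (fnv 7%N isT) -/(started _ _).
  have lt_cases i : (i < k.+1)%N -> i = k \/ (i < k)%N.
    by rewrite ltnS leq_eqVlt => /orP[/eqP|]; [left|right].
  case: ifP => cond; mem_simpl; rewrite ?s1k ?(fna 0%N isT).
    case/and3P: cond => nk fit; rewrite -ltnNge => big.
    split=> [i /lt_cases[->//|ik] ni fi|_]; last by split.
    exact: leq_trans (invl i ik ni fi) (ltnW big).
  split=> [i /lt_cases[->|ik] ni fi|/inv[? ? ? ?]]; last by split => //; exact: ltnW.
    by move: cond; rewrite ni fi /= => /negbT; rewrite negbK.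
  exact: invl.
Qed.

(** * Correctness of the allotment of processors *)

Definition alloc_at (R : realType) (s : state R) : Prop :=
  alloc_inv (nvar s 1) (rvar s 6) (rarr s 3) (rarr s 4) (nvar s 6) (narr s 5) (narr s 6)
    (rarr s 6) (nvar s 3) (narr s 2) (narr s 3) (narr s 4).

Definition allotted (R : realType) (s : state R) (j : nat) : nat :=
  \sum_(k < nvar s 3 | narr s 2 k == j) narr s 4 k.

Lemma split_progP (R : realType) (s : state R) :
  (nvar s 5 < nvar s 6)%N -> (nvar s 10 <= narr s 6 (nvar s 5))%N ->
  alloc_at s -> alloc_at (den split_prog s).
Proof. by move=> i_K need_l inv; exact: (alloc_split i_K need_l inv). Qed.

Lemma take_progP (R : realType) (s : state R) :
  (nvar s 5 < nvar s 6)%N -> rarr s 6 (nvar s 5) <= rvar s 6 ->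
  rarr s 3 (nvar s 8) = rvar s 6 -> rvar s 6 < rarr s 4 (nvar s 8) ->
  alloc_at s -> alloc_at (den take_prog s).
Proof. by move=> i_K free bj ej inv; exact: (alloc_take i_K free bj ej inv). Qed.

Lemma allotted_take (R : realType) (s : state R) (j : nat) :
  allotted (den take_prog s) j =
  (allotted s j + if j == nvar s 8 then narr s 6 (nvar s 5) else 0)%N.
Proof.
rewrite /allotted /take_prog; mem_simpl.
rewrite (sum_rcons (P := fun k => narr s 2 k == j)
  (P' := fun k => upd (narr s 2) (nvar s 3) (nvar s 8) k == j)).
  by rewrite updE eq_sym.
by move=> k kC; rewrite updN // neq_ltn kC.
Qed.

Lemma alloc_loop (R : realType) (s : state R) :
  let j := nvar s 8 in let t := rvar s 6 in let K := nvar s 6 in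
  alloc_at s -> nvar s 11 = K -> rarr s 3 j = t -> t < rarr s 4 j ->
  (nvar s 10 <= \sum_(i < K | (rarr s 6 i <= t)%R) narr s 6 i)%N ->
  spec (For 5 11 alloc_body) s (K * (ccost alloc_body + 10) + 8) (fun s' =>
    [/\ alloc_at s', (nvar s' 6 <= K.+1)%N,
        forall i, allotted s' i = (allotted s i + if i == j then nvar s 10 else 0)%N &
        forall k, (k < nvar s' 3)%N -> narr s' 2 k = j \/
          exists2 k', (k' < nvar s 3)%N & narr s' 2 k = narr s 2 k']).
Proof.
move=> j t K inv s11 bj ej fit; rewrite -s11.
(* As long as processors are lacking, no segment has been cut and the unvisited free ones cover the
   need. A cut brings the need to 0 and so is the only one. *)
apply: (spec_for (Inv := fun i s1 =>
  [/\ alloc_at s1, (K <= nvar s1 6 <= K.+1)%N,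
      forall i, (allotted s1 i + (if i == j then nvar s1 10 else 0) =
                 allotted s i + if i == j then nvar s 10 else 0)%N,
      forall k, (k < nvar s1 3)%N -> narr s1 2 k = j \/
        exists2 k', (k' < nvar s 3)%N & narr s1 2 k = narr s 2 k' &
      nvar s1 10 != 0%N -> nvar s1 6 = K /\
        (nvar s1 10 <= \sum_(i <= i' < K | (rarr s1 6 i' <= t)%R) narr s1 6 i')%N])) => //.
- split => //.
  + by mem_simpl; rewrite -/K leqnn leqnSn.
  + by move=> k kC; right; exists k.
  + by move=> _; split => //; mem_simpl; rewrite big_mkord.
- move=> i s1; rewrite s11 => iK s1i [fnv fna frv fra] [inv1 K1 size1 rec1 need1].
  apply: spec_loopfree => //; rewrite /alloc_body.
  have e8 : nvar s1 8 = j by rewrite (fnv 8%N isT).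
  have e6 : rvar s1 6 = t by rewrite (frv 6%N isT).
  have a3 : rarr s1 3 = rarr s 3 by rewrite (fra 3%N isT).
  have a4 : rarr s1 4 = rarr s 4 by rewrite (fra 4%N isT).
  set body := Seq _ take_prog.
  have -> : den (If (BAnd (RLe (RGet 6 (NVar 5)) (RVar 6)) (NLe (NConst 1) (NVar 10)))
      body Skip) s1 =
    if (rarr s1 6 (nvar s1 5) <= rvar s1 6) && (0 < nvar s1 10)%N then den body s1 else s1 by [].
  rewrite s1i e6; case: ifP => [/andP[free pos]|skip]; last first.
    split => // need0; have [KK le1] := need1 need0; split => //.
    move: skip le1; rewrite [nvar _ _]/= lt0n need0 andbT => /negbT nf.
    by rewrite big_ltn_cond // (negbTE nf).
  have iK1 : (i < nvar s1 6)%N by apply: leq_trans iK _; case/andP: K1.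
  have need0 : nvar s1 10 != 0%N by rewrite -lt0n.
  have [KK le1] := need1 need0.
  rewrite big_ltn_cond // free in le1.
  have [s2 [s2E [inv2 e2 K2 fl2 stay]]] : exists s2 : state R,
      den (If (NLe (NGet 6 (NVar 5)) (NVar 10)) Skip split_prog) s1 = s2 /\
      [/\ alloc_at s2,
        [/\ nvar s2 5 = i, nvar s2 8 = j, nvar s2 10 = nvar s1 10 & nvar s2 3 = nvar s1 3] /\
        [/\ rvar s2 6 = t, rarr s2 3 = rarr s 3, rarr s2 4 = rarr s 4,
            narr s2 2 = narr s1 2 & narr s2 4 = narr s1 4],
        (i < nvar s2 6)%N /\ (K <= nvar s2 6 <= K.+1)%N,
        rarr s2 6 i <= t /\ (narr s2 6 i <= nvar s1 10)%N &
        (nvar s1 10 - narr s2 6 i)%N != 0%N -> s2 = s1].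
    have -> : den (If (NLe (NGet 6 (NVar 5)) (NVar 10)) Skip split_prog) s1 =
      if (narr s1 6 (nvar s1 5) <= nvar s1 10)%N then s1 else den split_prog s1 by [].
    rewrite s1i; case: ifP => whole.
      exists s1; split => //; split => //.
    have need_l : (nvar s1 10 <= narr s1 6 i)%N by move/negbT: whole; lia.
    exists (den split_prog s1); split => //.
    have i_K : i != nvar s1 6 by rewrite neq_ltn iK1.
    have ll : narr (den split_prog s1) 6 i = nvar s1 10.
      by rewrite /split_prog; mem_simpl; rewrite s1i updN // updE.
    rewrite ll subnn; split => //.
    - by apply: split_progP; rewrite ?s1i.
    - by rewrite /split_prog; mem_simpl; rewrite add1n KK ltnS ltnW // leqnSn leqnn.
    - by rewrite /split_prog; mem_simpl; rewrite s1i updN // leqnn.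
  have {s2E} -> : den body s1 = den take_prog s2 by rewrite -s2E.
  case: e2 => [[h5 h8 h10 h3] [h6 g3 g4 h2 h4]].
  case: K2 => iK2 K2; case: fl2 => f2 l2.
  have n10 : nvar (set_nvar (den take_prog s2) 5 i.+1) 10 = (nvar s1 10 - narr s2 6 i)%N.
    by rewrite /take_prog; mem_simpl; rewrite h5 h10.
  split => //.
  + by apply: take_progP => //; rewrite ?h5 ?h6 ?h8 ?g3 ?g4.
  + move=> i'; rewrite n10 -size1 [allotted _ _](allotted_take s2 i') h5 h8.
    have -> : allotted s2 i' = allotted s1 i' by rewrite /allotted h3 h2 h4.
    by case: ifP => _ //; lia.
  + move=> k; rewrite /take_prog; mem_simpl; rewrite h8 h3 h2 add1n ltnS leq_eqVlt.
    case/orP => [/eqP->|kC]; first by left; rewrite updE.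
    by rewrite updN ?neq_ltn ?kC //; exact: rec1.
  + rewrite n10 => need'; have e21 := stay need'; subst s2.
    rewrite /take_prog; mem_simpl; split => //; rewrite s1i.
    rewrite leq_subLR; apply: leq_trans le1 _.
    rewrite leq_add2l leq_eqVlt; apply/orP; left; apply/eqP.
    by apply: congr_big_nat => // i' /andP[ii' _]; rewrite updN // neq_ltn ii' orbT.
- move=> s1 _ [inv1 /andP[_ K1] size1 rec1 need1]; split; rewrite ?s11 //.
  move=> i; rewrite -size1.
  (* No segment is left to visit, so a positive need would be bounded by an empty sum. *)
  have -> : nvar s1 10 = 0%N.
    apply/eqP/negPn/negP => /[dup] n0 /need1[_].
    by rewrite s11 big_geq // leqn0 (negbTE n0).
  by case: ifP => _; rewrite addn0.
Qed.

(** * The invariant of the event loop *)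

Section Schedule.
Variables (R : realType) (n m : nat) (q : nat -> nat) (p : nat -> R) (r D : R).
Hypothesis q0 : forall j, (j < n)%N -> (0 < q j <= m)%N.
Hypothesis p0 : forall j, (j < n)%N -> 0 < p j.
Hypothesis m0 : (0 < m)%N.
Hypothesis pD : forall j, (j < n)%N -> p j <= D.
Hypothesis area : \sum_(j < n) (q j)%:R * p j <= m%:R * D.

Definition state_pot (s : state R) : nat := potential n (rvar s 6) (narr s 7) (rarr s 4).

Definition state_busy (s : state R) : nat := busy n q (rvar s 6) (narr s 7) (rarr s 4).

(** In [sched_segs] the unstarted jobs pay for future cuts: a start adds at most one segment and
    removes one such job. *)
Record sched_inv (s : state R) : Prop := SchedInv {
  sched_env : [/\ nvar s 0 = n, nvar s 1 = m, narr s 0 = q & rarr s 7 = p];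
  sched_greedy : greedy_inv n m q p r (rvar s 6) (r + (2 - m%:R^-1) * D)
    (narr s 7) (rarr s 3) (rarr s 4);
  sched_alloc : alloc_at s;
  sched_rec : forall k, (k < nvar s 3)%N ->
    (narr s 2 k < n)%N /\ started (narr s 7) (narr s 2 k);
  sched_size : forall j, (j < n)%N -> started (narr s 7) j -> allotted s j = q j;
  sched_segs : (nvar s 6 + \sum_(j < n | ~~ started (narr s 7) j) 1 <= n.+1)%N }.

Lemma start_progP (s : state R) :
  let j := nvar s 8 in
  sched_inv s -> (j < n)%N -> ~~ started (narr s 7) j -> nvar s 9 = q j ->
  (q j <= m - state_busy s)%N ->
  (forall i, (i < n)%N -> ~~ started (narr s 7) i -> (q i <= m - state_busy s)%N ->
     (q i <= q j)%N) ->
  spec start_prog s (n.+1 * (ccost alloc_body + 10) + 30) (fun s' =>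
    sched_inv s' /\ (state_pot s' < state_pot s)%N).
Proof.
move=> j inv j_n nj s9 fit largest.
have [sn sm sq sp] := sched_env inv.
have galloc := sched_alloc inv.
have pj0 := p0 j_n.
have busyE := busy_alloc galloc (sched_rec inv) (sched_size inv).
rewrite /start_prog; set c1 := Seq (NPut 7 _ _) _.
have [s1 s1E] : exists s1, s1 = den c1 s by exists (den c1 s).
have done1 : narr s1 7 = upd (narr s 7) j 1%N by rewrite s1E.
have b1 : rarr s1 3 = upd (rarr s 3) j (rvar s 6) by rewrite s1E.
have e1 : rarr s1 4 = upd (rarr s 4) j (rvar s 6 + p j) by rewrite s1E -sp.
have n10 : nvar s1 10 = q j by rewrite s1E -s9.
have n11 : nvar s1 11 = nvar s1 6 by rewrite s1E.
have n6 : nvar s1 6 = nvar s 6 by rewrite s1E.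
have n8 : nvar s1 8 = j by rewrite s1E.
have n3 : nvar s1 3 = nvar s 3 by rewrite s1E.
have a2 : narr s1 2 = narr s 2 by rewrite s1E.
have t1 : rvar s1 6 = rvar s 6 by rewrite s1E.
have not_j k : (k < nvar s 3)%N -> narr s 2 k != j.
  by move=> kC; apply: contraNneq nj => <-; case: (sched_rec inv kC).
have alloc1 : alloc_at s1.
  rewrite /alloc_at b1 e1 s1E.
  apply: alloc_eq_times galloc => k kC.
  by rewrite !updN // (not_j _ kC).
have env1 : [/\ nvar s1 0 = n, nvar s1 1 = m, narr s1 0 = q & rarr s1 7 = p].
  by rewrite s1E.
have allot1 i : allotted s1 i = allotted s i by rewrite s1E.
have K_n : (nvar s 6 <= n.+1)%N by apply: leq_trans (sched_segs inv); rewrite leq_addr.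
apply: spec_le; first (apply/spec_seq/spec_loopfree => //; rewrite -s1E).
  apply/spec_frame/(spec_weaken (alloc_loop (s := s1) _ _ _ _ _)) => //.
  - by rewrite b1 n8 updE t1.
  - by rewrite e1 n8 updE t1 ltrDl.
  - rewrite n10; apply: leq_trans fit _.
    have [_ m1 _ _] := env1; rewrite -m1 -(alloc_total alloc1).
    rewrite n6 t1 /state_busy busyE s1E leq_subLR.
    rewrite (bigID (fun i : 'I_(nvar s 6) => (rvar s 6 < rarr s 6 i)%R)) /=.
    by rewrite leq_add2l leq_eqVlt; apply/orP; left; apply/eqP; apply: eq_bigl => i; rewrite leNgt.
  move=> s2 [alloc2 K2 size2 rec2] [fnv fna frv fra].
  have done2 : narr s2 7 = upd (narr s 7) j 1%N by rewrite (fna 7%N isT).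
  have e2 : rarr s2 4 = upd (rarr s 4) j (rvar s 6 + p j) by rewrite (fra 4%N isT).
  have t2 : rvar s2 6 = rvar s 6 by rewrite (frv 6%N isT).
  split; last first.
    by rewrite /state_pot done2 e2 t2; exact: potential_start.
  split => //.
  - by rewrite (fnv 0%N isT) (fnv 1%N isT) (fna 0%N isT) (fra 7%N isT).
  - rewrite t2 done2 e2 (fra 3%N isT) b1.
    exact: (greedy_start q0 p0 m0 pD area (sched_greedy inv)).
  - move=> k /rec2; rewrite n8 done2 n3 a2 => -[->|[k' k'C ->]].
      by rewrite started_upd eqxx.
    have [kn ks] := sched_rec inv k'C.
    by rewrite started_upd ks orbT.
  - move=> i i_n; rewrite done2 size2 started_upd n8 n10 allot1.
    have [-> _|ij /= si] := eqVneq i j.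
      by rewrite /allotted big_pred0 // => k; apply/negbTE/not_j.
    by rewrite addn0; exact: sched_size.
  - rewrite done2; have := sched_segs inv; rewrite n6 in K2.
    rewrite (bigD1 (Ordinal j_n)) //= add1n addnS => segs.
    apply: leq_trans segs; rewrite -addSn leq_add //.
    rewrite leq_eqVlt; apply/orP; left; apply/eqP; apply: eq_bigl => i.
    by rewrite started_upd negb_or andbC -(inj_eq val_inj i (Ordinal j_n)).
rewrite n6 /=; nia.
Qed.

(** The loop always makes 2 n rounds, and rounds after the last completion change nothing; hence a
    predecessor instead of a strict decrease. *)
Lemma step_progP (s : state R) : sched_inv s ->
  spec step_prog s (n.+1 * (ccost scan_body + ccost best_body + ccost alloc_body + 30) + 80)
    (fun s' => sched_inv s' /\ (state_pot s' <= (state_pot s).-1)%N).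
Proof.
move=> inv; have [sn sm sq sp] := sched_env inv.
rewrite /step_prog; set c1 := Seq (NSet 7 _) _; set c2 := Seq (NSet 8 _) _.
have [s1 s1E] : exists s1, s1 = den c1 s by exists (den c1 s).
have env1 : [/\ nvar s1 0 = n, nvar s1 1 = m, narr s1 0 = q & rarr s1 7 = p].
  by rewrite s1E.
have [n1 m1 q1 p1] := env1.
have n7 : nvar s1 7 = nvar s1 1 by rewrite s1E.
have r7 : rvar s1 7 = rvar s1 6 by rewrite s1E.
have t1 : rvar s1 6 = rvar s 6 by rewrite s1E.
have e1 : rarr s1 4 = rarr s 4 by rewrite s1E.
have done1 : narr s1 7 = narr s 7 by rewrite s1E.
have inv1 : sched_inv s1 by rewrite s1E; case: inv => *; split.
have sched_frame (s' : state R) : sched_inv s1 ->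
   (forall x, x \in [:: 0; 1; 3; 6]%N -> nvar s' x = nvar s1 x) ->
   narr s' = narr s1 -> rarr s' = rarr s1 -> rvar s' 6 = rvar s1 6 -> sched_inv s'.
  move=> [h1 h2 h3 h4 h5 h6] fn fa fr ft.
  by split; rewrite /alloc_at /allotted ?fn ?fa ?fr ?ft.
apply: spec_le; first (apply/spec_seq/spec_loopfree => //; rewrite -s1E).
  apply/spec_seq/spec_frame/(spec_weaken (scan_loop n7 r7) (leqnn _)).
  rewrite n1 m1 q1 t1 e1 done1 -/(state_busy s) => s2 [free2 next2] [fnv fna frv fra].
  apply/spec_seq/spec_loopfree => //.
  have [s3 s3E] : exists s3, s3 = den c2 s2 by exists (den c2 s2).
  rewrite -s3E.
  have n3 : nvar s3 0 = n by rewrite s3E -n1 -(fnv 0%N isT).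
  have free3 : nvar s3 7 = (m - state_busy s)%N by rewrite s3E -free2.
  have n9 : nvar s3 9 = 0%N by rewrite s3E.
  have q3 : narr s3 0 = q by rewrite s3E -q1 -(fna 0%N isT).
  have done3 : narr s3 7 = narr s 7 by rewrite s3E -done1 -(fna 7%N isT).
  have r3 : rvar s3 7 = rvar s2 7 by rewrite s3E.
  apply/spec_seq/spec_frame/(spec_weaken (best_loop n9)).
    by rewrite n3; exact: leqnn.
  rewrite n3 free3 q3 done3 => s4 [largest best] [gnv gna grv gra].
  have inv4 : sched_inv s4.
    apply: sched_frame => //.
    - by move=> x; rewrite !inE => /or4P[]/eqP->; rewrite gnv // s3E /= -?fnv.
    - by apply/funext => a; rewrite gna // s3E /= -fna.
    - by apply/funext => a; rewrite gra // s3E /= -fra.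
    - by rewrite grv // s3E /= -frv.
  have t4 : rvar s4 6 = rvar s 6 by rewrite (grv 6%N isT) s3E -t1 -(frv 6%N isT).
  have done4 : narr s4 7 = narr s 7 by rewrite (gna 7%N isT).
  have e4 : rarr s4 4 = rarr s 4 by rewrite (gra 4%N isT) s3E -e1 -(fra 4%N isT).
  have busy4 : state_busy s4 = state_busy s by rewrite /state_busy t4 done4 e4.
  have pot4 : state_pot s4 = state_pot s by rewrite /state_pot t4 done4 e4.
  have next4 : rvar s4 7 = rvar s2 7 by rewrite (grv 7%N isT).
  apply: (spec_if (B := n.+1 * (ccost alloc_body + 10) + 30)).
  have -> : beval s4 (NEq (NVar 9) (NConst 0)) = (nvar s4 9 == 0%N) by [].
  have [n9'|n9'] := eqVneq (nvar s4 9) 0%N; last first.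
    have [j_n nj sj fj] := best n9'.
    apply: spec_weaken (start_progP inv4 j_n _ _ _ _) (leqnn _) _.
    - by rewrite done4.
    - by rewrite -sj.
    - by rewrite busy4 sj.
    - by rewrite busy4 done4 sj.
    by move=> s5 [? lt5]; split => //; rewrite pot4 in lt5; lia.
  apply: spec_le (spec_loopfree _ _) _ => //.
  have nofit j : (j < n)%N -> ~~ started (narr s4 7) j -> (m - state_busy s4 < q j)%N.
    rewrite done4 busy4 => j_n nj; rewrite ltnNge; apply/negP => fit.
    by have := largest j j_n nj fit; have := q0 j_n; rewrite n9'; lia.
  have [tt' t'e] : rvar s4 6 <= rvar s4 7 /\ forall i, (i < n)%N ->
      running (rvar s4 6) (narr s4 7) (rarr s4 4) i -> rvar s4 7 <= rarr s4 4 i.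
    rewrite t4 next4 done4 e4; case: next2 => [[none ->]|[j [j_n runj] [-> jmin]]].
      by split => // i i_n runi; have := none i i_n; rewrite runi.
    by split; [case/andP: runj => _ /ltW|exact: jmin].
  split.
    have [h1 h2 h3 h4 h5 h6] := inv4; split => //.
      exact: greedy_advance h2 tt' t'e nofit.
    exact: alloc_advance tt' h3.
  rewrite -pot4 {1}/state_pot; mem_simpl.
  case: next2 => [[none _]|[j [j_n runj] [t'j _]]]; last first.
    rewrite -ltnS (ltn_predK (m := 0)).
      by apply: (potential_advance j_n); rewrite ?t4 ?done4 ?e4 // next4 t'j.
    rewrite pot4; apply: leq_ltn_trans (leq0n _)
      (potential_advance j_n (t' := rarr s 4 j) runj erefl).
  (* With nothing running, every job fits by size at most m, so none is unstarted; all have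
     ended. *)
  suff -> : potential n (rvar s4 7) (narr s4 7) (rarr s4 4) = 0%N by [].
  have busy0 : state_busy s4 = 0%N.
    by rewrite /state_busy /busy big_pred0 // => i; rewrite t4 done4 e4; exact/negbTE/none.
  rewrite /potential big1 // => i _; have i_n := ltn_ord i.
  case: ifPn => [si|/(nofit _ i_n)]; last by have := q0 i_n; rewrite busy0; lia.
  have := none i i_n; rewrite /running -done4 si -leNgt /= => ei.
  by rewrite ltNge e4 (le_trans ei) // -t4.
rewrite /=; nia.
Qed.

Lemma schedule_progP (s : state R) :
  [/\ nvar s 0 = n, nvar s 1 = m, narr s 0 = q & rarr s 7 = p] ->
  narr s 7 = (fun=> 0%N) -> rvar s 0 = r ->
  spec schedule_prog s ((n + n) * (n.+1 * (ccost scan_body + ccost best_body +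
      ccost alloc_body + 30) + 80 + 10) + 60)
    (fun s' => [/\ sched_inv s', forall j, (j < n)%N -> started (narr s' 7) j &
                   nvar s' 2 = n]).
Proof.
move=> env done0 sr.
rewrite /schedule_prog; set c1 := Seq (RSet 6 _) _.
have [s1 s1E] : exists s1, s1 = den c1 s by exists (den c1 s).
have [sn sm sq sp] := env.
have done1 : narr s1 7 = (fun=> 0%N) by rewrite s1E -done0.
have n2 : nvar s1 2 = n by rewrite s1E -sn.
have n12 : nvar s1 12 = (n + n)%N by rewrite s1E -sn.
have t1 : rvar s1 6 = r by rewrite s1E -sr.
have env1 : [/\ nvar s1 0 = n, nvar s1 1 = m, narr s1 0 = q & rarr s1 7 = p].
  by rewrite s1E.
have sum_n : (\sum_(j < n | ~~ started (fun=> 0%N) j) 1 = n)%N.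
  by rewrite sum1_card -[RHS]card_ord; apply: eq_card.
have inv1 : sched_inv s1.
  split => //.
  - by rewrite t1 done1; exact: greedy_init.
  - by rewrite /alloc_at s1E; apply: alloc_init.
  - by rewrite s1E.
  - by move=> j _; rewrite done1.
  - by rewrite done1 sum_n s1E.
apply: spec_le; first (apply/spec_seq/spec_loopfree => //; rewrite -s1E).
  apply: (spec_for (Inv := fun k s2 => sched_inv s2 /\ (state_pot s2 <= n + n - k)%N)) => //.
  - split; first by case: inv1 => *; split.
    rewrite subn0 /state_pot; mem_simpl; rewrite /potential done1.
    by rewrite sum_nat_const card_ord; lia.
  - move=> k s2 kn _ _ [inv2 pot2].
    apply: spec_weaken (step_progP inv2) (leqnn _) _ => s3 [inv3 pot3].
    split; first by case: inv3 => *; split.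
    have -> : state_pot (set_nvar s3 13 k.+1) = state_pot s3 by [].
    lia.
  move=> s2 [fnv _ _ _]; rewrite n12 subnn leqn0 => -[inv2 /eqP pot2].
  by split => //; [exact: (potential_eq0 pot2)|rewrite (fnv 2%N isT)].
rewrite n12 /=; nia.
Qed.

End Schedule.

(** * Feasibility of schedules in which each job runs once at constant speed *)

Lemma integral_step (R : realType) (A : set R) (b e c : R) : b < e ->
  (`[b, e[ `<=` A)%classic ->
  (\int[lebesgue_measure]_(t in A) (if b <= t < e then c else 0)%:E = ((e - b) * c)%:E)%E.
Proof.
move=> be subA.
have mbe : measurable (`[b, e[%classic : set R) by exact: measurable_itv.
transitivity (\int[lebesgue_measure]_(t in `[b, e[%classic) cst c%:E t)%E.
  rewrite integral_mkcond [RHS]integral_mkcond; apply: eq_integral => t _.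
  rewrite /patch !mem_setE in_itv /=.
  case: (boolP (b <= t < e)) => tbe; last by case: ifP.
  by rewrite mem_set //; apply: subA; rewrite /= in_itv.
by rewrite integral_cst //= lebesgue_measure_itv /= lte_fin be -EFinB -EFinM mulrC.
Qed.

Lemma measurable_step (R : realType) (b e c : R) :
  measurable_fun setT (fun t : R => if b <= t < e then c else 0).
Proof.
rewrite (_ : (fun t => _) = fun t => c * \1_(`[b, e[%classic : set R) t).
  by apply: measurable_funM => //; exact: measurable_indic.
apply/funext => t; rewrite indicE mem_setE in_itv /=.
by case: ifP; rewrite ?mulr1 ?mulr0.
Qed.

Section StepSchedule.
Variables (R : realType) (n m : nat) (pb : problem) (I : instance R n m).
Variables (S : schedule R n m) (r d : R) (b e c : 'I_n -> R).
Hypothesis rel : forall j, release I j = r.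
Hypothesis dl : forall j, deadline I j = d.
Hypothesis speedE : forall j t, speed S j t = if b j <= t < e j then c j else 0.
Hypothesis bounds : forall j, [/\ r <= b j, b j < e j & e j <= d].
Hypothesis c0 : forall j, 0 < c j.
Hypothesis cwork : forall j, (e j - b j) * c j = work I j.
Hypothesis sizes : forall j, #|procs S j| = jsize I j.
Hypothesis disj : forall i j t, i != j -> b i <= t < e i -> b j <= t < e j ->
  [disjoint procs S i & procs S j]%B.

Lemma executedE (j : 'I_n) (t : R) : executed S j t <-> b j <= t < e j.
Proof.
have -> : executed S j t = (0 < speed S j t) :> Prop by [].
by rewrite speedE; case: ifP => _; rewrite ?ltxx; split.
Qed.

Lemma feasible_steps : feasible pb I S.
Proof.
split => //.
- move=> j; rewrite (_ : speed S j = fun t => if b j <= t < e j then c j else 0).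
    exact: measurable_step.
  by apply/funext => t; exact: speedE.
- by move=> j t; rewrite speedE; case: ifP => // _; rewrite ltW.
- move=> j t /executedE /andP[bt te]; have [rb _ ed] := bounds j.
  by rewrite /= in_itv /= rel dl (le_trans rb bt) (lt_le_trans te ed).
- move=> j; under eq_integral do rewrite speedE.
  have [rb be ed] := bounds j.
  rewrite integral_step ?cwork // rel dl => t; rewrite /= !in_itv /= => /andP[bt te].
  by rewrite (le_trans rb bt) (lt_le_trans te ed).
- by move=> i j t ij /executedE bi /executedE bj; exact: disj bi bj.
- move=> _ j x y /executedE /andP[bx xe] /executedE /andP[_ ye] z /andP[xz zy].
  by apply/executedE; rewrite (le_trans bx xz) (le_lt_trans zy ye).
Qed.

End StepSchedule.

Theorem theorem1 (R : realType) (alpha : R) (halpha : 1 < alpha) :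
  exists (prog : com) (C : nat),
    forall (pb : problem) (n m : nat) (I : instance R n m) (r d : R),
      (0 < n)%N -> valid_instance I -> r < d ->
      (forall j, release I j = r) -> (forall j, deadline I j = d) ->
      exists (t : nat) (s : state R),
        [/\ exec prog (input I) t s,
            (t <= C * n ^ 2)%N,
            feasible pb I (output n m s) &
            (energy alpha (output n m s) <=
               ((2 - m%:R^-1) `^ (alpha - 1))%:E * min_energy alpha pb I)%E].
Proof.
exists (Seq dur_prog schedule_prog), 5000%N => pb n m I r d n0 valI rd rel dl.
pose s0 := input I; pose q := narr s0 0; pose W := rarr s0 0.
have qE (j : 'I_n) : q j = jsize I j.
  by rewrite -[q j]/(if insub (val j) is Some i then jsize I i else 0%N) valK.
have WE (j : 'I_n) : W j = work I j.
  by rewrite -[W j]/(if insub (val j) is Some i then work I i else 0) valK.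
have W0 j : (j < n)%N -> 0 < W j.
  by move=> j_n; have := (valI (Ordinal j_n)).1; rewrite -WE.
have q0 j : (j < n)%N -> (0 < q j <= m)%N.
  by move=> j_n; have := (valI (Ordinal j_n)).2; rewrite -qE.
have m0 : (0 < m)%N by case/andP: (q0 _ n0) => /leq_trans; apply.
have r0 : rarr s0 1 0%N = r.
  rewrite -(rel (Ordinal n0)) -[LHS]/(if insub 0%N is Some i then release I i else 0).
  by rewrite (insubT (fun i => i < n)%N n0).
have d0 : rarr s0 2 0%N = d.
  rewrite -(dl (Ordinal n0)) -[LHS]/(if insub 0%N is Some i then deadline I i else 0).
  by rewrite (insubT (fun i => i < n)%N n0).
pose D := d - r; have D0 : 0 < D by rewrite subr_gt0.
pose o := opt_dur n m q W D; pose v := opt_speed n m q W D.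
have v0 : 0 <= v := opt_speed_ge0 D0 W0 q0.
pose k : R := m%:R / (2 * m%:R - 1).
have m1 : 1 <= m%:R :> R by rewrite ler1n.
have mR : 0 < m%:R :> R by rewrite ltr0n.
have k0 : 0 < k by rewrite divr_gt0 //; lra.
have kE : (2 - m%:R^-1) * k = 1.
  by rewrite /k; field; rewrite !gt_eqF //; lra.
have pE j : scaled_dur n m q W D j = o j * k by rewrite /scaled_dur -mulrA.
have oP j := opt_durP (q := q) (m := m) D0 W0 q0 (j := j).
have [area1 area2] := opt_dur_area D0 W0 q0 n0.
(* The greedy bound is used with [D * k]: its deadline r + (2 - 1/m) D k is d by [kE]. *)
suff [t [s [ex tC [p [inv all_started n2 cost]]]]] :
    spec (Seq dur_prog schedule_prog) s0 (5000 * n ^ 2) (fun s => exists p,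
      [/\ sched_inv n m q p r (D * k) s, forall j, (j < n)%N -> started (narr s 7) j,
          nvar s 2 = n & forall j, (j < n)%N ->
            [/\ p j = o j * k, rarr s 5 j = W j / p j & narr s 1 j = j]]).
  exists t, s.
  have times (j : 'I_n) : [/\ r <= rarr s 3 j, rarr s 3 j < rarr s 4 j,
      rarr s 4 j <= d & rarr s 4 j - rarr s 3 j = o j * k].
    have [rb _ ee ed] := greedy_started (sched_greedy inv) (ltn_ord j)
      (all_started j (ltn_ord j)).
    have [oj0 _ _ _] := oP j (ltn_ord j); have [pj _ _] := cost j (ltn_ord j).
    have ok0 : 0 < o j * k by rewrite mulr_gt0.
    split=> //; rewrite ?ee ?pj ?ltrDl //; last by rewrite addrC addKr.
    rewrite -pj -ee; apply: le_trans ed _.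
    by rewrite mulrCA kE mulr1 /D addrC subrK.
  have speedE (j : 'I_n) x : speed (output n m s) j x =
      if rarr s 3 j <= x < rarr s 4 j then rarr s 5 j else 0.
    rewrite /= n2 big_mkcond (bigD1 j) //= big1 ?addr0 => [|i ij].
      by have [_ _ ->] := cost j (ltn_ord j); rewrite eqxx.
    have [_ _ ->] := cost i (ltn_ord i); rewrite (_ : (val i == j) = false) //.
    by apply/negbTE; rewrite (inj_eq val_inj).
  have c_gt0 (j : 'I_n) : 0 < rarr s 5 j.
    have [pj -> _] := cost j (ltn_ord j); have [oj0 _ _ _] := oP j (ltn_ord j).
    by rewrite pj; apply: divr_gt0; [exact: W0|exact: mulr_gt0].
  have cwork (j : 'I_n) : (rarr s 4 j - rarr s 3 j) * rarr s 5 j = work I j.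
    have [_ _ _ ->] := times j; have [pj -> _] := cost j (ltn_ord j).
    have [oj0 _ _ _] := oP j (ltn_ord j).
    by rewrite pj WE mulrC divfK // gt_eqF // mulr_gt0.
  have [_ em _ _] := sched_env inv.
  have alloc : alloc_inv m (rvar s 6) (rarr s 3) (rarr s 4) (nvar s 6) (narr s 5)
      (narr s 6) (rarr s 6) (nvar s 3) (narr s 2) (narr s 3) (narr s 4).
    by rewrite -em; exact: sched_alloc inv.
  have feas : feasible pb I (output n m s).
    apply: (feasible_steps pb rel dl speedE _ c_gt0 cwork).
    - by move=> j; have [] := times j.
    - move=> j; have [_ be _ _] := times j.
      rewrite -[procs _ j]/(alloc_procs m (nvar s 3) (narr s 2) (narr s 3) (narr s 4) j).
      rewrite (card_alloc_procs alloc be) -qE.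
      exact: sched_size inv _ (ltn_ord j) (all_started j (ltn_ord j)).
    - by move=> i j x ij bi bj; exact: disjoint_alloc_procs alloc ij bi bj.
  split => //.
  rewrite (energy_steps (b := fun j => rarr s 3 j) (e := fun j => rarr s 4 j)
    (c := fun j => rarr s 5 j) halpha feas) //; last by move=> j; have [] := times j.
  have -> : \sum_(j < n) (jsize I j)%:R *
        ((rarr s 4 j - rarr s 3 j) * rarr s 5 j `^ alpha) =
      (2 - m%:R^-1) `^ (alpha - 1) *
      \sum_(j < n) (jsize I j)%:R * (o j * (work I j / o j) `^ alpha).
    rewrite mulr_sumr; apply: eq_bigr => j _.
    have [_ _ _ ->] := times j; have [pj -> _] := cost j (ltn_ord j).
    have [oj0 _ _ _] := oP j (ltn_ord j); have Wj := W0 j (ltn_ord j).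
    (* Durations are multiplied by [k] and speeds by [k^-1], so each term gains the factor k
       k^(-alpha) = (k^-1)^(alpha - 1). *)
    have ik : 2 - m%:R^-1 = k^-1 by rewrite -[LHS](mulfK (lt0r_neq0 k0)) kE mul1r.
    have -> : W j / p j = (work I j / o j) * k^-1.
      by rewrite pj WE invfM mulrA.
    rewrite -WE powRM ?invr_ge0 ?(ltW k0) ?divr_ge0 ?ltW // ik.
    have -> : k^-1 `^ alpha = k^-1 `^ (alpha - 1) * k^-1.
      rewrite -[RHS](congr1 _ (powRr1 _)) ?invr_ge0 ?ltW // -powRD ?subrK //.
      by apply/implyP => _; rewrite gt_eqF ?invr_gt0.
    by field; rewrite gt_eqF.
  rewrite EFinM lee_wpmul2l ?lee_fin ?powR_ge0 //.
  apply: (@min_energy_ge R n m pb I alpha r d v (fun j => o j) halpha valI rd rel dl v0) => [j|vn0].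
    by have [? _ ? ?] := oP j (ltn_ord j); rewrite -WE.
  by under eq_bigr do rewrite -qE; exact: area2.
apply: spec_le.
  apply/spec_seq/spec_frame/(spec_weaken (dur_progP s0)) => //.
  rewrite r0 d0 => s1 [r1 dur1] [fnv fna frv fra].
  have p1 j : (j < n)%N -> rarr s1 7 j = o j * k.
    by move=> j_n; have [-> _ _] := dur1 j j_n; rewrite -pE.
  apply: spec_frame; apply: spec_weaken.
    apply: (schedule_progP (n := n) (m := m) (q := q) (p := rarr s1 7) (r := r)
      (D := D * k) q0 _ m0 _ _ (s := s1) _ _ r1).
    - by move=> j j_n; rewrite p1 // mulr_gt0 //; have [] := oP j j_n.
    - by move=> j j_n; rewrite p1 // ler_pM2r //; have [] := oP j j_n.
    - rewrite mulrA; under eq_bigr => j _ do rewrite p1 ?ltn_ord // mulrA.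
      by rewrite -mulr_suml ler_pM2r.
    - by rewrite (fnv 0%N isT) (fnv 1%N isT) (fna 0%N isT).
    - by rewrite (fna 7%N isT).
    - exact: leqnn.
  move=> s2 [inv all_started n2] [_ gna _ gra]; exists (rarr s1 7); split => // j j_n.
  have [_ c1 i1] := dur1 j j_n.
  by rewrite (gna 1%N isT) (gra 5%N isT) p1 // -p1.
rewrite -[nvar s0 0]/n /=.
have : (0 < n)%N := n0.
nia.
Qed.
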